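(* Let $T>0$ be a given (arbitrarily large) time horizon. Let $\mathcal{X}$ be a Hilbert space and suppose that $G:\mathbb{R}^d\times\mathscr{P}_2(\mathbb{R}^d)\to\mathbb{R}$ and $L:[0,T]\times\mathbb{R}^d\times\mathbb{R}^d\times\mathscr{P}_2(\mathbb{R}^d)\to\mathbb{R}$ admit the decomposition $$G(x,m_T)=g(x,\Sigma(m)_T),\qquad L(s,x,v,m_s)=\ell(s,x,v,\Sigma(m)_s)$$ for every curve $m=(m_s)_{s\in[0,T]}\in \mathrm{AC}([0,T];\mathscr{P}_2(\mathbb{R}^d))$, for some $g:\mathbb{R}^d\times\mathcal{X}\to\mathbb{R}$, $\ell:[0,T]\times\mathbb{R}^d\times\mathbb{R}^d\times\mathcal{X}\to\mathbb{R}$ and $\Sigma:\mathrm{AC}([0,T];\mathscr{P}_2(\mathbb{R}^d))\to C([0,T];\mathcal{X})$. Define $h(t,x,p,\sigma):=\sup_{v\in\mathbb{R}^d}\{p\cdot v-\ell(t,x,v,\sigma)\}$. (1) Suppose that the monotonicity condition $(\Sigma)$ (defined in the context) holds strictly. Suppose also that for every $\sigma=(\sigma_s)_{s\in[0,T]}\in\mathrm{range}(\Sigma)$ the Hamilton–Jacobi equation $$-\partial_t u+h(t,x,-\nabla_x u,\sigma_t)=0\ \text{ in }(0,T)\times\mathbb{R}^d,\qquad u(T,x)=g(x,\sigma_T),\ x\in\mathbb{R}^d,$$ has a unique classical solution $u$, and that the vector field $(t,x)\mapsto D_ph(t,x,-\nabla_xu(t,x),\sigma_t)$ has a globally defined flow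 on $[0,T]$. Then for every $m_0\in\mathscr{P}_2(\mathbb{R}^d)$ the mean field game with initial distribution $m_0$ has at most one Nash equilibrium. (2) Suppose instead that $L$ has the reduced form $L(t,x,v,m)=L(x,v)$ (so that only the terminal map $\Sigma_T:\mathscr{P}_2(\mathbb{R}^d)\to\mathcal{X}$ enters, $G(x,m)=g(x,\Sigma_T(m))$, and $h$ is independent of $t$ and $\sigma$), that the condition $(\sigma)$ (defined in the context) holds strictly, and that the same hypotheses on the Hamilton–Jacobi equation (with terminal datum $g(\cdot,\sigma)$, for every $\sigma\in\mathrm{range}(\Sigma_T)$) and on the flow of the vector field $D_ph(\cdot,-\nabla_xu)$ hold. Then again, for every $m_0\in\mathscr{P}_2(\mathbb{R}^d)$, the mean field game has at most one Nash equilibrium.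
   Context: $\mathscr{P}_2(\mathbb{R}^d)$ is the space of Borel probability measures on $\mathbb{R}^d$ with finite second moment, with the Wasserstein distance $W_2$; $\mathrm{AC}([0,T];\mathscr{P}_2(\mathbb{R}^d))$ is the set of absolutely continuous curves in it. The data $L,G$ are assumed sufficiently regular (at least continuously differentiable). Let $\Gamma=\mathrm{AC}(0,T;\mathbb{R}^d)$ be the space of absolutely continuous curves $\gamma:[0,T]\to\mathbb{R}^d$ (with the topology of uniform convergence and its Borel sets), $e_t(\gamma)=\gamma(t)=\gamma_t$, and $\Gamma[x]=\{\gamma\in\Gamma:\gamma(0)=x\}$. For $m_0\in\mathscr{P}_2(\mathbb{R}^d)$, $\mathscr{P}_{m_0}(\Gamma)$ is the set of Borel probability measures $\eta$ on $\Gamma$ with $(e_0)_\sharp\eta=m_0$; each such $\eta$ disintegrates as $\eta(d\gamma)=\int\eta_x(d\gamma)\,dm_0(x)$ with $\mathrm{spt}(\eta_x)\subset\Gamma[x]$ for $m_0$-a.e. $x$. Nash equilibrium: put $J^\eta[\gamma]=\int_0^TL(s,\gamma_s,\dot\gamma_s,(e_s)_\sharp\eta)\,ds+G(\gamma_T,(e_T)_\sharp\eta)$ and $\Gamma^\eta[x]=\{\bar\gamma\in\Gamma[x]:J^\eta[\bar\gamma]\le J^\eta[\gamma]\ \forall\gamma\in\Gamma[x]\}$. A (mean field game) Nash equilibrium for $m_0$ is an $\eta\in\mathscr{P}_{m_0}(\Gamma)$ such that $\mathrm{spt}(\eta_x)\subseteq\Gamma^\eta[x]$ for $m_0$-a.e.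 $x$. All flows of measures $s\mapsto(e_s)_\sharp\eta$ to which $\Sigma$ is applied are understood to belong to $\mathrm{AC}([0,T];\mathscr{P}_2(\mathbb{R}^d))$. Condition $(\Sigma)$: for $\sigma\in C([0,T];\mathcal{X})$ let $J^\sigma[\gamma]=\int_0^T\ell(s,\gamma_s,\dot\gamma_s,\sigma_s)\,ds+g(\gamma_T,\sigma_T)$, $\Gamma^\sigma[x]=\{\bar\gamma\in\Gamma[x]:J^\sigma[\bar\gamma]\le J^\sigma[\gamma]\ \forall\gamma\in\Gamma[x]\}$, and $$\mathcal{E}(\sigma)=\{\Sigma(((e_s)_\sharp\hat\eta)_{s\in[0,T]}):\hat\eta\in\mathscr{P}_{m_0}(\Gamma),\ \mathrm{spt}(\hat\eta_x)\subseteq\Gamma^\sigma[x]\text{ for }m_0\text{-a.e. }x\}.$$ $(\Sigma)$ holds if for all $m_0\in\mathscr{P}_2(\mathbb{R}^d)$ and all time horizons $T>0$: $\langle\tau_1-\tau_2,\sigma_1-\sigma_2\rangle_{L^2([0,T];\mathcal{X})}\le\|\sigma_1-\sigma_2\|^2_{L^2([0,T];\mathcal{X})}$ for all $\sigma_1,\sigma_2\in\mathrm{range}\,\Sigma$, $\tau_1\in\mathcal{E}(\sigma_1)$, $\tau_2\in\mathcal{E}(\sigma_2)$. It holds strictly if the inequality is strict whenever $\sigma_1\ne\sigma_2$. (When several horizons are considered, the data are understood to be given on each of them.) Condition $(\sigma)$ (for $L=L(x,v)$, $G(x,m)=g(x,\Sigma_T(m))$): for $\sigma\in\mathcal{X}$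 let $J^\sigma[\gamma]=\int_0^TL(\gamma_s,\dot\gamma_s)\,ds+g(\gamma_T,\sigma)$, define $\Gamma^\sigma[x]$ as the set of its minimizers over $\Gamma[x]$, and $\mathcal{E}_T(\sigma)=\{\Sigma_T((e_T)_\sharp\hat\eta):\hat\eta\in\mathscr{P}_{m_0}(\Gamma),\ \mathrm{spt}(\hat\eta_x)\subseteq\Gamma^\sigma[x]\text{ for }m_0\text{-a.e. }x\}$. $(\sigma)$ holds if for all $m_0\in\mathscr{P}_2(\mathbb{R}^d)$ and all $T>0$: $\langle\tau_1-\tau_2,\sigma_1-\sigma_2\rangle_{\mathcal{X}}\le\|\sigma_1-\sigma_2\|^2_{\mathcal{X}}$ for all $\sigma_1,\sigma_2\in\mathrm{range}\,\Sigma_T$, $\tau_i\in\mathcal{E}_T(\sigma_i)$. It holds strictly if the inequality is strict whenever $\sigma_1\ne\sigma_2$. *)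

(* Defs.v *)
From HB Require Import structures.
From mathcomp Require Import all_boot all_order all_algebra.
From mathcomp Require Import sesquilinear.
From mathcomp Require Import all_classical all_reals all_analysis.

Set Implicit Arguments.
Unset Strict Implicit.
Unset Printing Implicit Defensive.

Import Order.TTheory GRing.Theory Num.Theory.
Import numFieldNormedType.Exports.

Local Open Scope classical_set_scope.
Local Open Scope ring_scope.

(* Functions of time are total functions on R of which only the values on
   [0, T] are ever used. *)
Definition eq_on_time (R : realType) (A : Type) (T : R) (f g : R -> A) : Prop :=
  forall t, 0 <= t <= T -> f t = g t.

(* AC([0, T]; (A, dist)) in the metric sense: dist(gamma_s, gamma_t) is bounded
   by the integral over [s, t] of a fixed L^1 function. *)
Definition abs_continuous (R : realType) (A : Type) (dist : A -> A -> R)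
    (T : R) (gamma : R -> A) : Prop :=
  exists2 f : R -> R,
    lebesgue_measure.-integrable `[0, T] (EFin \o f) &
    forall s t, 0 <= s -> s <= t -> t <= T ->
      dist (gamma s) (gamma t) <= \int[lebesgue_measure]_(r in `[s, t]) f r.

Section Euclidean.
Context {R : realType} {d : nat}.
Local Notation V := 'rV[R]_d.

Definition dotv (u v : V) : R := \sum_(i < d) u 0 i * v 0 i.

(* The norm `|v| carried by 'rV[R]_d is the sup norm. *)
Definition enorm (v : V) : R := Num.sqrt (dotv v v).

Definition edist (x y : V) : R := enorm (x - y).

Definition grad (f : V -> R) (x : V) : V :=
  \row_(i < d) 'D_(delta_mx 0 i) f x.

End Euclidean.

Definition borel (R : realType) (d : nat) :=
  g_sigma_algebraType (@open 'rV[R]_d).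

Section Wasserstein.
Context {R : realType} {d : nat}.
Local Notation V := 'rV[R]_d.
Local Notation BV := (borel R d).

Record P2 := MkP2 {
  P2_prob :> probability BV R ;
  P2_moment : (\int[P2_prob]_x ((enorm (x : V)) ^+ 2)%:E < +oo)%E }.

(* Two terms of type P2 are the same measure when they agree on Borel sets;
   their values on other sets are irrelevant. *)
Definition P2_eq (mu nu : P2) : Prop :=
  forall B : set BV, measurable B -> mu B = nu B.

Definition coupling (mu nu : P2) (pi : probability (BV * BV)%type R) : Prop :=
  (forall B : set BV, measurable B -> pi (B `*` setT) = mu B) /\
  (forall B : set BV, measurable B -> pi (setT `*` B) = nu B).

Definition W2 (mu nu : P2) : R :=
  Num.sqrt (fine (ereal_inf
    [set (\int[pi]_z ((edist (z.1 : V) (z.2 : V)) ^+ 2)%:E)%E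
    | pi in coupling mu nu])).

End Wasserstein.
Arguments P2 : clear implicits.

(* An element of AC(0, T; R^d) is represented by its extension by 0 outside
   [0, T], so that equal curves are equal terms. *)
Record curve (R : realType) (d : nat) (T : R) := MkCurve {
  curve_fun :> R -> 'rV[R]_d ;
  curve_ac : abs_continuous edist T curve_fun ;
  curve_out : forall t, ~~ (0 <= t <= T) -> curve_fun t = 0 }.

Section CurveSpace.
Context {R : realType} {d : nat}.
Variable T : R.
Local Notation V := 'rV[R]_d.

Lemma zero_curve_ac : abs_continuous edist T (fun _ : R => 0 : V).
Proof.
exists (fun=> 0); first exact: integrable0.
move=> s t _ _ _; rewrite /edist /enorm subrr /dotv big1; last first.
  by move=> i _; rewrite !mxE mul0r.
by rewrite sqrtr0; apply: Rintegral_ge0.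
Qed.

HB.instance Definition _ := gen_eqMixin (curve d T).
HB.instance Definition _ := gen_choiceMixin (curve d T).
HB.instance Definition _ := isPointed.Build (curve d T)
  (MkCurve zero_curve_ac (fun _ _ => erefl)).

Definition uniform_open (U : set (curve d T)) : Prop :=
  forall gamma, U gamma -> exists2 e : R, 0 < e &
    forall gamma' : curve d T,
      (forall t, 0 <= t <= T -> edist (gamma t) (gamma' t) < e) -> U gamma'.

Definition Gamma := g_sigma_algebraType uniform_open.

Definition spt (mu : set Gamma -> \bar R) : set Gamma :=
  [set gamma | forall U : set Gamma, uniform_open U -> U gamma ->
     (0 < mu U)%E].

Definition Gamma_from (x : V) : set Gamma :=
  [set gamma : Gamma | (gamma : curve d T) 0 = x].

(* The leading and inner signs only fix the convention oo - oo = +oo for the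
   integral of a function with infinite positive and negative parts (\int
   itself has oo - oo = -oo); otherwise this is
   \int_0^T l(s, gamma_s, gamma'_s) ds + gT(gamma_T). *)
Definition cost (l : R -> V -> V -> R) (gT : V -> R) (gamma : curve d T) :
    \bar R :=
  (- (\int[lebesgue_measure]_(s in `[0%R, T])
        (- l s (gamma s) (derive1 gamma s))%:E)
   + (gT (gamma T))%:E)%E.

Definition minimizers (l : R -> V -> V -> R) (gT : V -> R) (x : V) :
    set Gamma :=
  [set gamma | Gamma_from x gamma /\
     forall gamma', Gamma_from x gamma' ->
       (cost l gT gamma <= cost l gT gamma')%E].

Definition initial_law (m0 : P2 R d) (eta : probability Gamma R) : Prop :=
  forall B : set (borel R d), measurable B ->
    eta [set gamma : Gamma | B ((gamma : curve d T) 0)] = m0 B.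

Definition disintegration (m0 : P2 R d) (eta : probability Gamma R)
    (k : R.-pker (borel R d) ~> Gamma) : Prop :=
  (forall A : set Gamma, measurable A -> eta A = (\int[m0]_x k x A)%E) /\
  {ae m0, forall x, spt (k x) `<=` Gamma_from x}.

Definition fibers_in (m0 : P2 R d) (M : V -> set Gamma)
    (eta : probability Gamma R) : Prop :=
  exists k : R.-pker (borel R d) ~> Gamma,
    disintegration m0 eta k /\ {ae m0, forall x, spt (k x) `<=` M x}.

(* (e_t)_# eta = mu, the left-hand side being in particular in P2 *)
Definition law_at (eta : probability Gamma R) (t : R) (mu : P2 R d) : Prop :=
  forall B : set (borel R d), measurable B ->
    eta [set gamma : Gamma | B ((gamma : curve d T) t)] = mu B.

Definition flow_of (eta : probability Gamma R) (m : R -> P2 R d) : Prop :=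
  forall t, 0 <= t <= T -> law_at eta t (m t).

Definition AC_P2 (m : R -> P2 R d) : Prop := abs_continuous W2 T m.

Definition has_AC_flow (eta : probability Gamma R) : Prop :=
  exists2 m, flow_of eta m & AC_P2 m.

Definition nash_equilibrium (L : R -> V -> V -> P2 R d -> R)
    (G : V -> P2 R d -> R) (m0 : P2 R d) (eta : probability Gamma R) : Prop :=
  initial_law m0 eta /\
  exists2 m, flow_of eta m &
    fibers_in m0
      (minimizers (fun s x v => L s x v (m s)) (fun x => G x (m T))) eta.

End CurveSpace.

Section Hilbert.
Context {R : realType} {d : nat} {X : completeNormedModType R}.
Variable ip : {dot X for idfun}.
Local Notation V := 'rV[R]_d.

Definition L2_ip (T : R) (f g : R -> X) : R :=
  \int[lebesgue_measure]_(s in `[0, T]) ip (f s) (g s).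

(* Sigma : AC([0, T]; P2) -> C([0, T]; X): it only depends on the measures
   m_t, t in [0, T], and takes continuous values. *)
Definition is_curve_map (T : R) (Sigma : (R -> P2 R d) -> (R -> X)) : Prop :=
  (forall m, AC_P2 T m -> {within `[0, T], continuous (Sigma m)}) /\
  (forall m m', AC_P2 T m -> AC_P2 T m' ->
     (forall t, 0 <= t <= T -> P2_eq (m t) (m' t)) ->
     eq_on_time T (Sigma m) (Sigma m')).

Definition range_Sigma (T : R) (Sigma : (R -> P2 R d) -> (R -> X)) :
    set (R -> X) :=
  [set Sigma m | m in @AC_P2 R d T].

Definition E_Sigma (T : R) (l : R -> V -> V -> X -> R) (g : V -> X -> R)
    (Sigma : (R -> P2 R d) -> (R -> X)) (m0 : P2 R d) (sigma : R -> X) :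
    set (R -> X) :=
  [set tau | exists (eta : probability (@Gamma R d T) R) (m : R -> P2 R d),
     [/\ initial_law m0 eta,
         fibers_in m0
           (minimizers (fun s x v => l s x v (sigma s))
                       (fun x => g x (sigma T))) eta,
         flow_of eta m, AC_P2 T m & tau = Sigma m]].

(* l and Sigma are given on every horizon, hence indexed by T first. *)
Definition strict_Sigma_condition (l : R -> R -> V -> V -> X -> R)
    (g : V -> X -> R) (Sigma : R -> (R -> P2 R d) -> (R -> X)) : Prop :=
  forall (m0 : P2 R d) (T : R), 0 < T ->
  forall sigma1 sigma2 tau1 tau2 : R -> X,
    range_Sigma T (Sigma T) sigma1 -> range_Sigma T (Sigma T) sigma2 ->
    E_Sigma T (l T) g (Sigma T) m0 sigma1 tau1 ->
    E_Sigma T (l T) g (Sigma T) m0 sigma2 tau2 ->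
    let dsigma := fun s => sigma1 s - sigma2 s in
    let dtau := fun s => tau1 s - tau2 s in
    L2_ip T dtau dsigma <= L2_ip T dsigma dsigma /\
    (~ eq_on_time T sigma1 sigma2 ->
       L2_ip T dtau dsigma < L2_ip T dsigma dsigma).

Definition E_terminal (T : R) (L : V -> V -> R) (g : V -> X -> R)
    (SigmaT : P2 R d -> X) (m0 : P2 R d) (sigma : X) : set X :=
  [set tau | exists (eta : probability (@Gamma R d T) R) (mu : P2 R d),
     [/\ initial_law m0 eta,
         fibers_in m0
           (minimizers (fun _ x v => L x v) (fun x => g x sigma)) eta,
         law_at eta T mu & tau = SigmaT mu]].

Definition strict_sigma_condition (L : V -> V -> R) (g : V -> X -> R)
    (SigmaT : P2 R d -> X) : Prop :=
  forall (m0 : P2 R d) (T : R), 0 < T ->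
  forall sigma1 sigma2 tau1 tau2 : X,
    range SigmaT sigma1 -> range SigmaT sigma2 ->
    E_terminal T L g SigmaT m0 sigma1 tau1 ->
    E_terminal T L g SigmaT m0 sigma2 tau2 ->
    ip (tau1 - tau2) (sigma1 - sigma2) <= `|sigma1 - sigma2| ^+ 2 /\
    (sigma1 <> sigma2 ->
       ip (tau1 - tau2) (sigma1 - sigma2) < `|sigma1 - sigma2| ^+ 2).

End Hilbert.

Section Regularity.
Context {R : realType} {d : nat}.
Local Notation V := 'rV[R]_d.

Definition jointly_continuous (W : normedModType R) (T : R)
    (F : R -> V -> V -> P2 R d -> W) : Prop :=
  forall s x v mu, 0 <= s <= T -> forall e : R, 0 < e ->
  exists2 delta : R, 0 < delta & forall s' x' v' mu', 0 <= s' <= T ->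
    `|s' - s| < delta -> edist x' x < delta -> edist v' v < delta ->
    W2 mu' mu < delta -> `|F s' x' v' mu' - F s x v mu| < e.

(* C^1 in the Euclidean variables (x, v); in time and in the measure only
   continuity, of F and of its gradients, is asked for. A terminal cost is
   covered as a function that ignores s and v. *)
Definition C1_data (T : R) (F : R -> V -> V -> P2 R d -> R) : Prop :=
  [/\ @jointly_continuous R^o T F,
      forall s mu, 0 <= s <= T ->
        forall z : V * V, differentiable (fun z => F s z.1 z.2 mu) z,
      jointly_continuous T (fun s x v mu => grad (fun y => F s y v mu) x)
    & jointly_continuous T (fun s x v mu => grad (fun w => F s x w mu) v)].

End Regularity.

Section HamiltonJacobi.
Context {R : realType} {d : nat}.
Local Notation V := 'rV[R]_d.

Definition hamiltonian (l : V -> R) (p : V) : \bar R :=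
  ereal_sup [set (dotv p v - l v)%:E | v in [set: V]].

(* u in C([0, T] x R^d) and C^1((0, T) x R^d) solves
   - d_t u + H(t, x, - grad_x u) = 0 on (0, T) x R^d and u(T, .) = gT. *)
Definition classical_solution (T : R) (H : R -> V -> V -> \bar R)
    (gT : V -> R) (u : R -> V -> R) : Prop :=
  [/\ {within [set z : R * V | 0 <= z.1 <= T],
         continuous (fun z : R * V => u z.1 z.2)},
      forall t x, 0 < t < T ->
        [/\ differentiable (fun z : R * V => u z.1 z.2) (t, x),
            {for (t, x), continuous (fun z : R * V => derive1 (u ^~ z.2) z.1)}
          & {for (t, x), continuous (fun z : R * V => grad (u z.1) z.2)}],
      forall t x, 0 < t < T ->
        ((- derive1 (u ^~ x) t)%:E + H t x (- grad (u t) x)%R = 0)%E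
    & forall x, u T x = gT x].

(* Existence, for every starting point x at time 0, of a C^1 integral curve of
   b on [0, T] (w is its velocity extended to the end points), unique among
   absolutely continuous integral curves. *)
Definition has_global_flow (T : R) (b : R -> V -> V) : Prop :=
  exists Phi : V -> R -> V, forall x,
  [/\ Phi x 0 = x,
      {within `[0, T], continuous (Phi x)},
      exists2 w : R -> V, {within `[0, T], continuous w} &
        forall t, 0 < t < T -> is_derive t 1 (Phi x) (w t) /\
                               w t = b t (Phi x t)
    & forall gamma : curve d T, gamma 0 = x ->
        {ae lebesgue_measure, forall t, 0 < t < T ->
           derivable gamma t 1 /\ derive1 gamma t = b t (gamma t)} ->
        eq_on_time T gamma (Phi x)].

Definition HJ_hypothesis (T : R) (l : R -> V -> V -> R) (gT : V -> R) : Prop :=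
  let H := fun t x => hamiltonian (l t x) in
  exists u : R -> V -> R,
  [/\ classical_solution T H gT u,
      forall u', classical_solution T H gT u' ->
        forall t x, 0 <= t <= T -> u' t x = u t x,
      forall t x, 0 < t < T ->
        (\forall q \near - grad (u t) x, H t x q \is a fin_num) /\
        differentiable (fun q => fine (H t x q)) (- grad (u t) x)
    & has_global_flow T
        (fun t x => grad (fun q => fine (H t x q)) (- grad (u t) x))].

End HamiltonJacobi.

(* Main.v *)
Require Import Defs.
From HB Require Import structures.
From mathcomp Require Import all_boot all_order all_algebra.
From mathcomp Require Import sesquilinear.
From mathcomp Require Import all_classical all_reals all_analysis.
From mathcomp Require Import measurable_realfun ring lra.

Set Implicit Arguments.
Unset Strict Implicit.
Unset Printing Implicit Defensive.

Import Order.TTheory GRing.Theory Num.Theory.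
Import numFieldNormedType.Exports.

Local Open Scope classical_set_scope.
Local Open Scope ring_scope.

(** An equilibrium eta determines a path sigma in the Hilbert space, and eta is
    itself a best response to sigma: sigma belongs to its own set of responses.
    For two equilibria with different paths sigma1 and sigma2, the strict
    monotonicity condition, applied with tau_i = sigma_i, would say that
    |sigma1 - sigma2|^2 is smaller than itself. So both equilibria face the same
    optimal control problem.

    This problem has at most one minimizer from each initial point
    ([unique_minimizer]). Indeed, along any curve the derivative of
    u(t, gamma_t) plus the cost density is the gap in the Fenchel inequality
    between the Lagrangian and the Hamiltonian; integrating it
    ([verification]) shows that a curve which costs at most u(0, x) has an optimal
    velocity almost everywhere. A Hamiltonian that is differentiable at the
    momentum in question has its gradient there as the only optimal velocity
    ([maximizer_unique], [maximizer_exists]), so such a curve is an integral curve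
    of the feedback vector field, and the flow hypothesis leaves only one. That
    curve does cost u(0, x) ([cost_optimal_curve]), so every minimizer coincides
    with it.

    Therefore the fibers of both equilibria over almost every x are supported in
    the same singleton. Since the space of curves is second countable
    ([step_tube_basis]), a probability measure gives no mass to the complement of
    its support ([spt_co_null]); the fibers are thus equal Dirac masses, and the
    equilibria agree by integration over x ([fibers_in_unique]).

    The analytic input is the fundamental theorem of calculus for absolutely
    continuous functions ([AC_FTC]), obtained from Radon-Nikodym and the Lebesgue
    differentiation theorem. It is needed because the curves are differentiable
    almost everywhere only, while u is C^1 only at interior times; the end
    points are reached by monotone convergence. *)

(** * Absolutely continuous functions of one variable *)

Lemma lebesgue_stieltjes_itvoc (R : realType) (F : cumulative R R) (s t : R) :
  s <= t -> lebesgue_stieltjes_measure F `]s, t]%classic = (F t - F s)%:E.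
Proof.
move=> st.
rewrite /lebesgue_stieltjes_measure /measure_extension measurable_mu_extE/=;
  last exact: is_ocitv.
by rewrite wlength_itv_bnd.
Qed.

(** The Stieltjes measures of F and H add up to the measure with density g,
    because they do so on half-open intervals. Hence the one of F is dominated
    by an absolutely continuous measure, and Radon-Nikodym applies to it. *)
Lemma stieltjes_density (R : realType) (F H g : R -> R) :
  nondecreasing F -> right_continuous F ->
  nondecreasing H -> right_continuous H ->
  (forall x, 0 <= g x) ->
  lebesgue_measure.-integrable setT (EFin \o g) ->
  (forall s t, s <= t -> (((F t - F s) + (H t - H s))%:E =
     \int[lebesgue_measure]_(x in `]s, t]) (g x)%:E)%E) ->
  exists2 phi : R -> R, lebesgue_measure.-integrable setT (EFin \o phi) &
    forall s t, s <= t -> F t - F s = \int[lebesgue_measure]_(x in `]s, t]) phi x.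
Proof.
move=> ndF rcF ndH rcH g0 ig FHg.
pose Fc : cumulative R R := HB.pack F (isCumulative.Build R _ R F ndF rcF).
pose Hc : cumulative R R := HB.pack H (isCumulative.Build R _ R H ndH rcH).
have ndG : nondecreasing (F \+ H) by move=> x y xy /=; rewrite lerD ?ndF ?ndH.
have rcG : right_continuous (F \+ H).
  by move=> x; apply: cvgD; [exact: rcF|exact: rcH].
pose Gc : cumulative R R := HB.pack (F \+ H) (isCumulative.Build R _ R (F \+ H) ndG rcG).
pose nuF := lebesgue_stieltjes_measure Fc.
pose nuH := lebesgue_stieltjes_measure Hc.
have ind_ge0 E : (0 <= induced_charge ig E)%E.
  by apply: integral_ge0 => x _; rewrite lee_fin.
have ind_dom (A : set R) : measurable A -> lebesgue_measure A = 0 ->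
    induced_charge ig A = 0.
  move=> mA A0; apply: null_set_integral => //.
  by apply: measurable_funTS; exact: (measurable_int _ ig).
pose D := measure_of_charge _ ind_ge0.
have GD : forall A, measurable A -> lebesgue_stieltjes_measure Gc A = D A.
  apply: lebesgue_stieltjes_measure_unique => X /ocitvP[->|[[s t] /= st ->]].
    by rewrite !measure0.
  rewrite lebesgue_stieltjes_itvoc ?(ltW st)//.
  rewrite [RHS](_ : _ = \int[lebesgue_measure]_(x in `]s, t]) (g x)%:E)%E//.
  rewrite -FHg ?(ltW st)//=; by congr (_%:E); ring.
have GFH : forall A, measurable A -> lebesgue_stieltjes_measure Gc A = measure_add nuF nuH A.
  apply: lebesgue_stieltjes_measure_unique => X /ocitvP[->|[[s t] /= st ->]].
    by rewrite !measure0.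
  transitivity (nuF `]s, t]%classic + nuH `]s, t]%classic)%E; last first.
    by rewrite -measure_addE.
  rewrite /nuF /nuH !lebesgue_stieltjes_itvoc ?(ltW st)//=.
  by rewrite -EFinD; congr (_%:E); ring.
have nuFD A : measurable A -> (nuF A <= D A)%E.
  move=> mA; rewrite -GD// GFH//.
  have -> : measure_add nuF nuH A = (nuF A + nuH A)%E by exact: measure_addE.
  by rewrite leeDl.
have finF : fin_num_fun nuF.
  move=> A mA; rewrite ge0_fin_numE//; apply: (le_lt_trans (nuFD _ mA)).
  by rewrite -ge0_fin_numE//; exact: fin_num_measure.
pose nuFf : {finite_measure set (measurableTypeR R) -> \bar R} :=
  HB.pack nuF (Measure_isFinite.Build _ _ _ nuF finF).
have domF : nuFf `<< (@lebesgue_measure R).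
  apply/null_content_dominatesP => A mA A0.
  apply/eqP; rewrite eq_le measure_ge0 andbT.
  apply: (le_trans (nuFD _ mA)).
  by have -> : D A = 0%E := ind_dom A mA A0.
have [f [f0 ffin fint fE]] := radon_nikodym_sigma_finite domF.
exists (fine \o f).
  apply: eq_integrable fint => // x _ /=; by rewrite fineK.
move=> s t st.
have /= := fE `]s, t]%classic (measurable_itv _).
rewrite /nuF lebesgue_stieltjes_itvoc//= => /(congr1 fine)/= ->.
by rewrite /Rintegral; congr fine; apply: eq_integral => x _; rewrite /= fineK.
Qed.

Lemma integral_itv_small (R : realType) (g : R -> R) :
  lebesgue_measure.-integrable setT (EFin \o g) ->
  forall e : R, 0 < e -> exists2 d : R, 0 < d & forall s t, t - s < d ->
    \int[lebesgue_measure]_(x in `[s, t]) `|g x| < e.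
Proof.
move=> ig e e0; have [d [d0 dP]] := integral_normr_continuous ig e0.
exists d => // s t std.
have h : (lebesgue_measure `[s, t]%classic < d%:E)%E.
  by rewrite lebesgue_measure_itv/= lte_fin; case: ifPn => [st|_]; rewrite ?lte_fin.
exact: dP.
Qed.

Section Clamp.
Context {R : realType}.
Implicit Types a b s t : R.

Definition clamp a b t := Num.max a (Num.min b t).

Lemma clamp_in a b t : a <= b -> a <= clamp a b t <= b.
Proof. by move=> ab; rewrite /clamp le_max lexx/= ge_max ab/= ge_min lexx. Qed.

Lemma clamp_id a b t : a <= t <= b -> clamp a b t = t.
Proof. by move=> /andP[at_ tb]; rewrite /clamp min_r// max_r. Qed.

Lemma clamp_homo a b s t : s <= t -> clamp a b s <= clamp a b t.
Proof.
move=> st; rewrite /clamp ge_max le_max lexx/= le_max; apply/orP; right.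
by rewrite le_min ge_min lexx/= ge_min st orbT.
Qed.

Lemma clamp_continuous a b : continuous (clamp a b).
Proof.
have lip s t : s <= t -> `|clamp a b s - clamp a b t| <= t - s.
  move=> st; rewrite distrC ger0_norm ?subr_ge0 ?clamp_homo//.
  rewrite /clamp; case: (leP b s) => ?; case: (leP b t) => ?;
    try case: (leP a b) => ?; try case: (leP a s) => ?; try case: (leP a t) => ?; lra.
move=> t; apply/cvgrPdist_lt => e e0; near=> s.
have ste : `|t - s| < e by near: s; exact: (@cvgr_dist_lt _ R^o _ _ _ id t cvg_id).
apply: le_lt_trans ste; have [st|ts] := leP s t.
  by rewrite distrC (le_trans (lip _ _ st))// ler_norm.
by rewrite (le_trans (lip _ _ (ltW ts)))// distrC ler_norm.
Unshelve. all: by end_near. Qed.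

End Clamp.

Section AbsolutelyContinuous.
Context {R : realType}.
Implicit Types (a b : R) (U f g : R -> R).

(** Lebesgue's fundamental theorem of calculus for a function whose increments
    are bounded by the integrals of f. With I the primitive of |f|, both I + U
    and I - U are nondecreasing and their increments add up to those of 2 I, so
    the Stieltjes measure of I + U has a density; the Lebesgue differentiation
    theorem identifies it with the derivative. *)
Lemma AC_FTC a b U f : a < b ->
  lebesgue_measure.-integrable `[a, b] (EFin \o f) ->
  (forall s t, a <= s -> s <= t -> t <= b ->
     `|U t - U s| <= \int[lebesgue_measure]_(r in `[s, t]) f r) ->
  exists psi : R -> R,
  [/\ lebesgue_measure.-integrable `[a, b] (EFin \o psi),
      U b - U a = \int[lebesgue_measure]_(r in `[a, b]) psi r &
      {ae lebesgue_measure, forall t, a < t < b -> is_derive t 1 U (psi t)}].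
Proof.
move=> ab fi Uf.
(* f need not be nonnegative, whereas I has to be monotone. *)
pose g x := `|(f \_ `[a, b]) x|.
have g0 x : 0 <= g x by exact: normr_ge0.
have ig : lebesgue_measure.-integrable setT (EFin \o g).
  have : lebesgue_measure.-integrable setT (EFin \o (f \_ `[a, b])).
    by rewrite -restrict_EFin; apply/integrable_restrict => //=; rewrite setTI.
  by move/integrable_norm.
pose I t := \int[lebesgue_measure]_(x in `]-oo, t]) g x.
have II s t : s <= t -> I t - I s = \int[lebesgue_measure]_(x in `]s, t]) g x.
  move=> st; apply: Rintegral_itvB => //.
  exact: integrableS ig.
have mI s t : s <= t -> I s <= I t.
  by move=> st; rewrite -subr_ge0 II//; apply: Rintegral_ge0.
have cI : continuous I.
  move=> t; apply/cvgrPdist_lt => e e0.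
  have [d d0 dP] := integral_itv_small ig e0.
  have h u v : u <= v -> v - u < d -> I v - I u < e.
    move=> uv uvd; rewrite II// (le_lt_trans _ (dP _ _ uvd))//.
    rewrite Rintegral_itv_obnd_cbnd//; last exact: integrableS ig.
    rewrite le_eqVlt; apply/orP; left; apply/eqP; apply: eq_Rintegral => x _.
    by rewrite ger0_norm.
  near=> s.
  have std : `|t - s| < d by near: s; exact: (@cvgr_dist_lt _ R^o _ _ _ id t cvg_id).
  have [st|ts] := leP s t.
    by rewrite ger0_norm ?subr_ge0 ?mI// h// (le_lt_trans _ std)// ler_norm.
  rewrite distrC ger0_norm ?subr_ge0 ?mI ?(ltW ts)// h ?(ltW ts)//.
  by rewrite (le_lt_trans _ std)// distrC ler_norm.
(* Stieltjes measures need functions on the whole line: U is extended by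
   constants outside [a, b]. *)
pose V t := U (clamp a b t).
have VI s t : s <= t -> `|V t - V s| <= I t - I s.
  move=> st; have /andP[as_ sb] := clamp_in s (ltW ab).
  have /andP[at_ tb] := clamp_in t (ltW ab).
  have [cst|cts] := ltP (clamp a b s) (clamp a b t); last first.
    rewrite /V.
    have -> : clamp a b s = clamp a b t.
      by apply/eqP; rewrite eq_le cts andbT clamp_homo.
    by rewrite subrr normr0 subr_ge0 mI.
  have scs : s <= clamp a b s.
    rewrite leNgt; apply/negP => h.
    move: cst; rewrite ltNge => /negP; apply.
    move: h; rewrite {1}/clamp gt_max => /andP[as1]; rewrite gt_min ltxx orbF => bs.
    by rewrite (le_trans tb)// /clamp min_l ?(ltW bs)// le_max lexx orbT.
  have ctt : clamp a b t <= t.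
    rewrite leNgt; apply/negP => h.
    move: cst; rewrite ltNge => /negP; apply.
    move: h; rewrite {1}/clamp lt_max lt_min ltxx andbF orbF => ta.
    by rewrite {1}/clamp max_l// ge_min (ltW ta) orbT.
  apply: (@le_trans _ _ (I (clamp a b t) - I (clamp a b s))); last first.
    by apply: lerB; apply: mI.
  rewrite (le_trans (Uf _ _ as_ (ltW cst) tb))// II ?(ltW cst)//.
  rewrite Rintegral_itv_obnd_cbnd//; last exact: integrableS ig.
  have sub : `[clamp a b s, clamp a b t] `<=` `[a, b].
    by apply: subset_itvScc; rewrite bnd_simp.
  apply: le_Rintegral => //.
  - exact: integrableS fi.
  - exact: integrableS ig.
  - move=> x xst; rewrite /g patchE mem_set; first exact: ler_norm.
    exact: sub.
have cV : continuous V.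
  move=> t; apply/cvgrPdist_lt => e e0.
  have /cvgrPdist_lt/(_ e e0) := cI t; apply: filterS => s.
  apply: le_lt_trans.
  have [st|ts] := leP s t.
    by rewrite (le_trans (VI _ _ st))// ler_norm.
  by rewrite distrC (le_trans (VI _ _ (ltW ts)))// distrC ler_norm.
have VlI s t : s <= t -> - (I t - I s) <= V t - V s <= I t - I s.
  by move=> /VI; rewrite ler_norml.
have [phi iphi phiE] : exists2 phi : R -> R,
    lebesgue_measure.-integrable setT (EFin \o phi) &
    forall s t, s <= t -> (I \+ V) t - (I \+ V) s = \int[lebesgue_measure]_(x in `]s, t]) phi x.
  apply: (@stieltjes_density _ (I \+ V) (I \- V) (fun x => 2 * g x)).
  - by move=> s t st /=; have /andP[] := VlI _ _ st; lra.
  - by apply: right_continuousW => x; apply: cvgD; [exact: cI|exact: cV].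
  - by move=> s t st /=; have /andP[] := VlI _ _ st; lra.
  - by apply: right_continuousW => x; apply: cvgB; [exact: cI|exact: cV].
  - by move=> x; rewrite mulr_ge0.
  - have := @integrableZl _ _ _ _ _ measurableT 2 _ ig.
    by apply: eq_integrable => //.
  - move=> s t st.
    under eq_integral do rewrite EFinM.
    rewrite integralZl//; last exact: integrableS ig.
    rewrite -[X in (_ * X)%E]fineK; last first.
      by apply: integrable_fin_num => //; exact: integrableS ig.
    rewrite -EFinM; congr (_%:E).
    have := II _ _ st; rewrite /Rintegral => <- /=; ring.
exists (phi \- g); split.
- have := @integrableB _ _ _ _ _ measurableT _ _ iphi ig.
  by apply: integrableS.
- rewrite -Rintegral_itv_obnd_cbnd; last first.
    apply: (@integrableS _ _ _ _ setT) => //.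
    exact: (@integrableB _ _ _ _ _ measurableT _ _ iphi ig).
  rewrite RintegralB//; [|exact: integrableS iphi|exact: integrableS ig].
  rewrite -II ?(ltW ab)// -phiE ?(ltW ab)//= /V !clamp_id ?lexx ?(ltW ab)//.
  by ring.
- have aeI : {ae lebesgue_measure, forall x, derivable I x 1 /\ derive1 I x = g x}.
    apply: FTC1Ny.
      by move=> y; exact: integrableS ig.
    exact: open_integrable_locally openT ig.
  pose P x := \int[lebesgue_measure]_(t in `]-oo, x]) phi t.
  have aeF : {ae lebesgue_measure, forall x, derivable P x 1 /\ derive1 P x = phi x}.
    apply: FTC1Ny.
      by move=> y; exact: integrableS iphi.
    exact: open_integrable_locally openT iphi.
  have PE : I \+ V = P \+ cst ((I \+ V) 0 - P 0).
    apply/funext => x.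
    suff : (I \+ V) x - (I \+ V) 0 = P x - P 0 by rewrite /=; lra.
    have [x0|x0] := leP 0 x.
      by rewrite phiE// Rintegral_itvB//; exact: integrableS iphi.
    apply: oppr_inj; rewrite !opprB phiE ?(ltW x0)//.
    by rewrite Rintegral_itvB ?bnd_simp ?(ltW x0)//; exact: integrableS iphi.
  have VE : V = P \+ cst ((I \+ V) 0 - P 0) \- I.
    by rewrite -PE; apply/funext => x /=; ring.
  apply: filterS2 aeI aeF; first exact: (ae_filter_ringOfSetsType lebesgue_measure).
  move=> t [dI I'] [dP P'] /andP[ta tb].
  have Vd : is_derive t 1 V ((phi \- g) t).
    rewrite VE -[(phi \- g) t]/(phi t - g t) -[phi t]addr0.
    have h1 : is_derive t 1 I (g t) by apply: DeriveDef; [exact: dI|rewrite -derive1E; exact: I'].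
    have h2 : is_derive t 1 P (phi t) by apply: DeriveDef; [exact: dP|rewrite -derive1E; exact: P'].
    apply: is_deriveB.
  apply: near_eq_is_derive Vd => //.
  near=> x; rewrite /V clamp_id//; apply/andP; split; apply: ltW.
    by near: x; exact: lt_nbhsr.
  by near: x; exact: lt_nbhsl.
Unshelve. all: by end_near. Qed.

End AbsolutelyContinuous.

Lemma abs_continuous_modulus (R : realType) (A : Type) (dist : A -> A -> R)
    (T : R) (gamma : R -> A) (e : R) :
  abs_continuous dist T gamma -> 0 < e ->
  exists2 delta : R, 0 < delta & forall s t, 0 <= s -> s <= t -> t <= T ->
    t - s < delta -> dist (gamma s) (gamma t) < e.
Proof.
move=> [f fi fg] e0.
have ig : lebesgue_measure.-integrable setT (EFin \o (f \_ `[0, T])).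
  by rewrite -restrict_EFin; apply/integrable_restrict => //=; rewrite setTI.
have [delta delta0 small] := integral_itv_small ig e0.
exists delta => // s t s0 st tT std.
apply: le_lt_trans (small s t std); apply: (le_trans (fg s t s0 st tT)).
have sub : `[s, t] `<=` `[0, T] by apply: subset_itvScc; rewrite bnd_simp.
apply: le_Rintegral => //.
- exact: integrableS fi.
- by apply: integrableS (integrable_norm ig).
- by move=> x /sub x0T; rewrite patchE mem_set// ler_norm.
Qed.

(** * Integrals and null sets *)

Section NullSets.
Import HBNNSimple.
Context {d : measure_display} {T : measurableType d} {R : realType}.
Variable mu : {measure set T -> \bar R}.
Local Open Scope ereal_scope.

Lemma ge0_integral_null (N : set T) (f : T -> \bar R) :
  measurable N -> mu N = 0 -> (forall x, 0 <= f x) ->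
  \int[mu]_x f x = \int[mu]_x (f \_ (~` N)) x.
Proof.
move=> mN N0 f0.
have mNC := measurableC mN.
have f0' x : 0 <= (f \_ (~` N)) x by rewrite patchE; case: ifPn.
apply/eqP; rewrite eq_le; apply/andP; split; rewrite !ge0_integralTE//.
  apply: ge_ereal_sup => _ [h /= hf <-].
  apply: ereal_sup_ubound; exists (proj_nnsfun h mNC).
    move=> x /=; rewrite patchE /mindic indicE; case: ifPn => xN; rewrite ?mulr1 ?mulr0//.
  rewrite -!integralT_nnsfun [RHS](@ge0_negligible_integral _ _ _ mu setT N)//.
  - rewrite setTD [RHS]integral_mkcond; apply: eq_integral => x _ /=.
    by rewrite patchE /mindic indicE; case: ifPn => // _; rewrite (mulr1,mulr0).
  - by apply/measurable_EFinP; exact: measurable_funPT.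
  - by move=> x _; rewrite lee_fin.
apply: ge_ereal_sup => _ [h /= hf <-].
apply: ereal_sup_ubound; exists h => // x; apply: (le_trans (hf x)).
by rewrite patchE; case: ifPn.
Qed.

(** This holds even for a nonmeasurable f, because the integral of a
    nonnegative function is a supremum over simple functions below it, and these
    may be cut off on N. The integrand of the cost is of this kind: it involves
    derive1 of a curve, whose values are arbitrary outside a set of full measure. *)
Lemma integral_null (D N : set T) (f : T -> \bar R) :
  measurable N -> mu N = 0 ->
  \int[mu]_(x in D) f x = \int[mu]_(x in D `\` N) f x.
Proof.
move=> mN N0; rewrite integralE [RHS]integralE; congr (_ - _);
  rewrite integral_mkcond (ge0_integral_null mN N0);
  [|by move=> x; exact: erestrict_ge0 | |by move=> x; exact: erestrict_ge0];
  by rewrite -integral_mkcond -integral_mkcondr setDE setIC.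
Qed.
End NullSets.

(** * Euclidean and supremum norms *)

Section EuclideanNorm.
Context {R : realType} {d : nat}.
Implicit Types v : 'rV[R]_d.

Lemma coord_le_norm v i : `|v 0 i| <= `|v|.
Proof.
rewrite [leRHS]/Num.Def.normr /= mx_normrE; apply/bigmax_geP; right => /=.
by exists (ord0, i).
Qed.

Lemma norm_le_coord v (e : R) : 0 <= e -> (forall i, `|v 0 i| <= e) -> `|v| <= e.
Proof.
move=> e0 h; rewrite [leLHS]/Num.Def.normr /= mx_normrE; apply/bigmax_leP; split => //.
by move=> [i j] _ /=; rewrite ord1.
Qed.

Lemma norm_lt_coord v (e : R) : 0 < e -> (forall i, `|v 0 i| < e) -> `|v| < e.
Proof.
move=> e0 h; rewrite [ltLHS]/Num.Def.normr /= mx_normrE; apply/bigmax_ltP; split => //.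
by move=> [i j] _ /=; rewrite ord1.
Qed.

Lemma dotv_ge0 v : 0 <= dotv v v.
Proof. by apply: sumr_ge0 => i _; rewrite -expr2 sqr_ge0. Qed.

Lemma coord_le_enorm v i : `|v 0 i| <= enorm v.
Proof.
rewrite -sqrtr_sqr /enorm ler_sqrt ?dotv_ge0//.
rewrite /dotv (bigD1 i)//= -expr2 lerDl; apply: sumr_ge0 => j _.
by rewrite -expr2 sqr_ge0.
Qed.

Lemma enorm_ge0 v : 0 <= enorm v. Proof. exact: sqrtr_ge0. Qed.

Lemma norm_le_enorm v : `|v| <= enorm v.
Proof. by apply: norm_le_coord; [exact: enorm_ge0|exact: coord_le_enorm]. Qed.

Lemma enorm_le_norm v : enorm v <= d.+1%:R * `|v|.
Proof.
rewrite -[leRHS]ger0_norm ?mulr_ge0// -sqrtr_sqr /enorm ler_sqrt ?sqr_ge0//.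
apply: (@le_trans _ _ (\sum_(i < d) `|v| ^+ 2)).
  apply: ler_sum => i _; rewrite -expr2 -real_normK ?num_real//.
  by rewrite lerXn2r ?nnegrE// coord_le_norm.
rewrite sumr_const card_ord exprMn -[leLHS]mulr_natl; apply: ler_wpM2r; first exact: sqr_ge0.
by rewrite -natrX ler_nat (leq_trans (leqnSn d))// expnS expn1 leq_pmulr.
Qed.

End EuclideanNorm.

(** * The space of curves *)

Section CurveSpaceTopology.
Context {R : realType} {d : nat} {T : R}.
Local Notation V := 'rV[R]_d.
Implicit Types gamma : curve (R := R) d T.

Lemma curve_modulus gamma (e : R) : 0 < e ->
  exists2 delta : R, 0 < delta & forall s t, 0 <= s -> s <= t -> t <= T ->
    t - s < delta -> `|gamma s - gamma t| < e.
Proof.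
move=> e0; have [delta delta0 mod] := abs_continuous_modulus (curve_ac gamma) e0.
exists delta => // s t s0 st tT std.
exact: le_lt_trans (norm_le_enorm _) (mod s t s0 st tT std).
Qed.

Definition step_path (n : nat) (q : seq 'rV[rat]_d) (t : R) : V :=
  map_mx ratr (nth 0 q (Num.truncn (t * n.+1%:R))).

(** Centred at a step path and not at a curve, so that countably many centres
    suffice; the radius is shrunk strictly in order that the tube be open. *)
Definition step_tube (c : nat * seq 'rV[rat]_d * rat) : set (@Gamma R d T) :=
  [set gamma : @Gamma R d T | exists2 r : R, r < ratr c.2 & forall t, 0 <= t <= T ->
     `|(gamma : curve d T) t - step_path c.1.1 c.1.2 t| <= r].

Lemma step_tube_open c : uniform_open (step_tube c).
Proof.
case: c => [[n q] r] gamma [r' r'r tube]; rewrite /= in r'r tube.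
exists ((ratr r - r') / 2); first by rewrite divr_gt0// subr_gt0.
move=> gamma' gg'; exists (r' + (ratr r - r') / 2) => /=; first by lra.
move=> t t0T; rewrite -(subrK (gamma t) (gamma' t)) -addrA addrC.
rewrite (le_trans (ler_normD _ _))// lerD ?tube//.
rewrite distrC (le_trans (norm_le_enorm _))//.
by rewrite ltW// gg'.
Qed.

Lemma rat_vector_approx (v : V) (e : R) : 0 < e ->
  exists q : 'rV[rat]_d, `|v - map_mx ratr q| < e.
Proof.
move=> e0.
have /(_ _)/cid2 h : forall i, exists2 q : rat, true & `|v 0 i - ratr q| < e.
  move=> i; have /rat_in_itvoo[q /[!in_itv]/= /andP[q1 q2]] : v 0 i - e < v 0 i + e.
    by lra.
  by exists q => //; rewrite ltr_norml; apply/andP; split; lra.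
exists (\row_i s2val (h i)); apply: norm_lt_coord => // i.
by rewrite !mxE; exact: (s2valP' (h i)).
Qed.

(** The topology of uniform convergence on the space of curves is second
    countable: every curve is uniformly approximated by a step path with
    rational values. *)
Lemma step_tube_basis (U : set (@Gamma R d T)) (gamma : @Gamma R d T) :
  uniform_open U -> U gamma ->
  exists c, step_tube c gamma /\ step_tube c `<=` U.
Proof.
move=> oU /oU [e e0 eU].
have [r /[!in_itv]/= /andP[r0 re]] : exists r : rat, ratr r \in `](0:R), (e / (2 * d.+1%:R))[.
  by apply: rat_in_itvoo; rewrite divr_gt0 ?mulr_gt0.
(* A third of the radius pays for the oscillation of gamma on a mesh interval,
   another one for the rational approximation. *)
have [delta delta0 dP] := curve_modulus gamma (divr_gt0 r0 (ltr0Sn _ 2)).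
pose n := Num.truncn delta^-1.
have nd : n.+1%:R^-1 < delta.
  by rewrite invf_plt ?posrE//; apply: real_truncnS_gt; rewrite num_real.
pose node i : R := i%:R / n.+1%:R.
have /choice[Q QP] : forall i, exists q : 'rV[rat]_d,
    `|(gamma : curve d T) (node i) - map_mx ratr q| < ratr r / 3.
  by move=> i; apply: rat_vector_approx; rewrite divr_gt0.
pose c := (n, mkseq Q (Num.truncn (T * n.+1%:R)).+1, r).
have gc : step_tube c gamma.
  exists (ratr r / 3 + ratr r / 3) => /=; first by lra.
  move=> t /andP[t0 tT].
  have tn0 : 0 <= t * n.+1%:R by rewrite mulr_ge0.
  rewrite /step_path nth_mkseq; last by rewrite ltnS le_truncn// ler_wpM2r.
  set i := Num.truncn _.
  have /andP[it ti] := truncn_itv tn0.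
  have node_t : node i <= t by rewrite /node ler_pdivrMr.
  have t_node : t - node i < n.+1%:R^-1.
    rewrite ltrBlDr /node -{1}[n.+1%:R^-1]mul1r -mulrDl ltr_pdivlMr//.
    by rewrite addrC natr1.
  rewrite -(subrK ((gamma : curve d T) (node i)) ((gamma : curve d T) t)) -addrA.
  rewrite (le_trans (ler_normD _ _))// lerD//; last exact/ltW/QP.
  rewrite distrC ltW// dP//; last exact: lt_trans nd.
  by rewrite /node divr_ge0.
exists c; split => // gamma' [r1 r1r tube1]; have [r2 r2r tube2] := gc.
rewrite /= in r1r r2r; apply: eU => t t0T; apply: le_lt_trans (enorm_le_norm _) _.
have re2 : ratr r * (2 * d.+1%:R) < e by rewrite -ltr_pdivlMr// mulr_gt0.
rewrite -(subrK (step_path n (mkseq Q (Num.truncn (T * n.+1%:R)).+1) t) ((gamma : curve d T) t)) -addrA.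
have tube12 := lerD (tube2 t t0T) (tube1 t t0T).
rewrite [X in _ + X <= _]distrC in tube12.
apply: le_lt_trans re2; rewrite mulrC [leRHS]mulrA ler_wpM2r//.
by rewrite (le_trans (ler_normD _ _))// (le_trans tube12)//; lra.
Qed.
End CurveSpaceTopology.

(** * Supports of measures on the space of curves *)

Section Support.
Context {R : realType} {d : nat} {T : R}.
Local Notation Gam := (@Gamma R d T).
Variable mu : {measure set Gam -> \bar R}.
Local Open Scope ereal_scope.

Lemma uniform_open_measurable (U : set Gam) : uniform_open U -> measurable U.
Proof. by move=> oU; exact: sub_gen_smallest. Qed.

(** The complement of the support is a union of null open sets, and by second
    countability a countable one. *)
Lemma spt_co_null : mu.-negligible (~` spt mu).
Proof.
pose F (n : nat) : set Gam := if unpickle n is Some c then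
  (if mu (@step_tube R d T c) == 0 then @step_tube R d T c else set0) else set0.
have : mu.-negligible (\bigcup_n F n).
  apply: negligible_bigcup => n; rewrite /F; case: unpickle => [c|]; last exact: negligible_set0.
  case: ifPn => [/eqP c0|_]; last exact: negligible_set0.
  exists (@step_tube R d T c); split => //.
  by apply: uniform_open_measurable; exact: step_tube_open.
apply: negligibleS => gamma /existsNP[U /not_implyP[oU /not_implyP[Ug U0]]].
have [c [cg cU]] := step_tube_basis oU Ug.
exists (pickle c) => //; rewrite /F pickleK ifT//.
have mc : measurable (@step_tube R d T c).
  by apply: uniform_open_measurable; exact: step_tube_open.
rewrite eq_le measure_ge0 andbT; apply: (@le_trans _ _ (mu U)); last by rewrite leNgt; exact/negP.
by rewrite le_measure// inE//; exact: uniform_open_measurable.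
Qed.

Lemma spt_sub1_dirac (gamma : Gam) : mu setT = 1 -> spt mu `<=` [set gamma] ->
  forall A : set Gam, measurable A -> mu A = \d_gamma A.
Proof.
move=> mu1 sg A mA.
have null B : measurable B -> ~ B gamma -> mu B = 0.
  move=> mB Bg; apply: measure_negligible => //.
  apply: negligibleS spt_co_null => x Bx /sg xg; apply: Bg.
  by move: Bx; rewrite xg.
rewrite diracE; case: (boolP (gamma \in A)) => gA /=; last first.
  by apply: null => //; move: gA; rewrite notin_setE.
rewrite -[LHS]adde0 -(null (~` A)).
- by rewrite -measureU// ?setUCr ?setICr//; exact: measurableC.
- exact: measurableC.
- by move=> /(_ (set_mem gA)).
Qed.
End Support.

(** * Differentiable Hamiltonians *)

Section Dot.
Context {R : realType} {d : nat}.
Local Notation V := 'rV[R]_d.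
Implicit Types u v w p q : V.

Lemma dotvDl u v w : dotv (u + v) w = dotv u w + dotv v w.
Proof. by rewrite /dotv -big_split /=; apply: eq_bigr => i _; rewrite mxE mulrDl. Qed.

Lemma dotvNl u w : dotv (- u) w = - dotv u w.
Proof. by rewrite /dotv -sumrN; apply: eq_bigr => i _; rewrite mxE mulNr. Qed.

Lemma dotvZl (a : R) u w : dotv (a *: u) w = a * dotv u w.
Proof. by rewrite /dotv mulr_sumr; apply: eq_bigr => i _; rewrite mxE mulrA. Qed.

Lemma dotv_delta i w : dotv (delta_mx 0 i) w = w 0 i.
Proof.
rewrite /dotv (bigD1 i)//= mxE !eqxx mul1r big1 ?addr0// => j ji.
by rewrite mxE eqxx (negPf ji) mul0r.
Qed.

Lemma dotv_continuous p : continuous (dotv p).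
Proof.
have cont_add : continuous (fun z : R * R => z.1 + z.2).
  by move=> z; apply: cvgD; [exact: cvg_fst|exact: cvg_snd].
rewrite /dotv => v.
apply: (@cvg_big _ _ _ _ predT cont_add _ (nbhs v) _
  (fun i (w : V) => p 0 i * w 0 i) _ (nbhs_filter v)) => i _.
by apply: cvgM; [exact: cvg_cst|exact: coord_continuous].
Qed.

End Dot.

(** At a point p of differentiability of the Hamiltonian, that is of the
    Legendre transform of l, the supremum that defines it is attained at the
    gradient and nowhere else. The differentiability of the transform plays
    the part that strict convexity and superlinear growth of l play classically. *)
Section LegendreTransform.
Context {R : realType} {d : nat}.
Local Notation V := 'rV[R]_d.
Variables (l : V -> R) (p : V).
Local Notation H := (hamiltonian l).
Hypothesis Hfin : \forall q \near p, H q \is a fin_num.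
Hypothesis Hdiff : differentiable (fun q => fine (H q)) p.
Local Notation vstar := (grad (fun q => fine (H q)) p).

Lemma le_hamiltonian q v : H q \is a fin_num -> dotv q v - l v <= fine (H q).
Proof.
by move=> fq; rewrite -lee_fin fineK//; apply: ereal_sup_ubound; exists v.
Qed.

(** Almost maximizers are close to the gradient: if v is optimal up to
    delta at p, then the increments of H at p along s e_i and - s e_i are at
    least s v_i - delta and - s v_i - delta, while the derivative of H bounds
    them from above. *)
Lemma maximizer_coord_near i (e : R) : 0 < e ->
  \forall delta \near 0^'+, forall v, fine (H p) - delta <= dotv p v - l v ->
    `|v 0 i - vstar 0 i| <= e.
Proof.
move=> e0; pose D : V := delta_mx 0 i.
have dD : derivable (fun q => fine (H q)) p D by exact: diff_derivable.
have Vi : vstar 0 i = 'D_D (fun q => fine (H q)) p by rewrite mxE.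
have near_line : \forall h \near (0 : R)^', H (h *: D + p) \is a fin_num.
  have : (fun h : R => h *: D + p) @ (0 : R)^' --> p.
    have h : (fun h : R => h *: D + p) @ (0 : R)^' --> 0 *: D + p.
      apply: cvgD; last exact: cvg_cst.
      apply: cvgZ; last exact: cvg_cst.
      by apply: cvg_within_filter; exact: cvg_id.
    by rewrite scale0r add0r in h.
  by move=> /(_ _ Hfin).
have e20 : 0 < e / 2 by rewrite divr_gt0.
have near_quot : \forall h \near (0 : R)^',
    `|vstar 0 i - h^-1 * (fine (H (h *: D + p)) - fine (H p))| < e / 2.
  move: dD => /cvgrPdist_lt/(_ _ e20); rewrite Vi.
  by apply: filterS => h.
have [s0 /= s00 sP] : exists2 s0 : R, 0 < s0 & forall h, h != 0 -> `|h| < s0 ->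
    H (h *: D + p) \is a fin_num /\
    `|vstar 0 i - h^-1 * (fine (H (h *: D + p)) - fine (H p))| < e / 2.
  have [s0 /= s00 sP] := filterI near_line near_quot.
  exists s0 => // h h0 hs; apply: sP => //=.
  by rewrite sub0r normrN.
pose s := s0 / 2.
have s_gt0 : 0 < s by rewrite divr_gt0.
have ss0 : `|s| < s0 by rewrite gtr0_norm// /s; lra.
have sNs0 : `|- s| < s0 by rewrite normrN.
have [fs qs] := sP s (lt0r_neq0 s_gt0) ss0.
have [fNs qNs] := sP (- s) (ltr0_neq0 (ltac:(by rewrite oppr_lt0) : - s < 0)) sNs0.
near=> delta => v vmax.
have small : delta <= s * (e / 2).
  by near: delta; apply: nbhs_right_ltW; rewrite mulr_gt0.
have Es := le_hamiltonian v fs; have ENs := le_hamiltonian v fNs.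
rewrite dotvDl dotvZl dotv_delta in Es; rewrite dotvDl dotvZl dotv_delta in ENs.
move: qs qNs; rewrite !ltr_norml => /andP[qs1 qs2] /andP[qNs1 qNs2].
set hs := fine (H (s *: D + p)) in Es qs1 qs2.
set hNs := fine (H (- s *: D + p)) in ENs qNs1 qNs2.
have Bs : hs - fine (H p) <= s * (vstar 0 i + e / 2).
  by rewrite -ler_pdivrMl//; lra.
have BNs : hNs - fine (H p) <= s * (- vstar 0 i + e / 2).
  by rewrite -ler_pdivrMl//; move: qNs1 qNs2; rewrite invrN mulNr; lra.
rewrite ler_norml; apply/andP; split; rewrite -(ler_pM2l s_gt0); nra.
Unshelve. all: by end_near. Qed.

Lemma maximizer_unique v : dotv p v - l v = fine (H p) -> v = vstar.
Proof.
move=> vmax; apply/rowP => i; apply/eqP; rewrite -subr_eq0 -normr_le0.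
apply/ler_addgt0Pl => e e0; rewrite addr0.
near (0 : R)^'+ => delta.
have : forall w, fine (H p) - delta <= dotv p w - l w -> `|w 0 i - vstar 0 i| <= e.
  by near: delta; exact: maximizer_coord_near.
by apply; rewrite vmax lerBlDr lerDl.
Unshelve. all: by end_near. Qed.

Lemma maximizer_exists : {for vstar, continuous l} ->
  dotv p vstar - l vstar = fine (H p).
Proof.
move=> cl; have fp : H p \is a fin_num by exact: nbhs_singleton Hfin.
apply/eqP; rewrite eq_le le_hamiltonian//=.
apply/ler_addgt0Pr => e e0.
have e20 : 0 < e / 2 by rewrite divr_gt0.
have : (fun v => dotv p v - l v) @ vstar --> dotv p vstar - l vstar.
  have c1 := @dotv_continuous _ _ p vstar.
  exact: (cvgB c1 cl).
move=> /cvgrPdist_lt/(_ _ e20)/nbhs_ballP[eta /= eta0 cont].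
near (0 : R)^'+ => delta.
have del0 : 0 < delta by [].
have close : forall i w, fine (H p) - delta <= dotv p w - l w -> `|w 0 i - vstar 0 i| <= eta / 2.
  by near: delta; apply: filter_forall => i; apply: maximizer_coord_near; rewrite divr_gt0.
have dele : delta < e / 2 by near: delta; exact: nbhs_right_lt.
have [_ [v _ <-] vmax] : exists2 x, [set (dotv p v - l v)%:E | v in [set: V]] x &
    ((fine (H p) - delta)%:E < x)%E.
  by apply: ereal_sup_gt; rewrite -[ltRHS]fineK// lte_fin ltrBlDr ltrDl.
rewrite lte_fin in vmax.
have : ball vstar eta v.
  rewrite mx_norm_ball /ball_ /=; apply: norm_lt_coord => // i.
  rewrite mxE [X in _ + X]mxE distrC; apply: (le_lt_trans (close i v (ltW vmax))); lra.
move/cont; rewrite /= ltr_norml => /andP[]; lra.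
Unshelve. all: by end_near. Qed.

End LegendreTransform.

(** * Functions of time and space along paths *)

Lemma compact_norm_bound (R : realType) (S : topologicalType) (W : normedModType R)
    (K : set S) (f : S -> W) :
  compact K -> {in K, continuous f} ->
  exists2 C : R, 0 <= C & forall z, K z -> `|f z| <= C.
Proof.
move=> cK cf.
have [M [_ MP]] := compact_bounded (continuous_compact (continuous_in_subspaceT cf) cK).
exists (`|M| + 1); first by rewrite addr_ge0.
move=> z Kz; apply: MP; last by exists z.
by rewrite (le_lt_trans (ler_norm M))// ltrDl.
Qed.

Lemma is_derive_affine (R : realType) (W : normedModType R) (x v : W) (r : R) :
  is_derive r (1 : R) (fun r => x + r *: v) v.
Proof.
have lim_v : (fun h : R => h^-1 *: ((x + (h *: (1 : R) + r) *: v) - (x + r *: v))) @ 0^' --> v.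
  apply: cvg_near_cst; near=> h.
  rewrite opprD addrACA subrr add0r -scalerBl addrK scalerA [h *: 1]mulr1 mulVf ?scale1r//.
  by near: h; exact: nbhs_dnbhs_neq.
apply: DeriveDef; first by apply/cvg_ex; exists v.
exact/cvg_lim.
Unshelve. all: by end_near. Qed.

Section TimeSpaceCalculus.
Context {R : realType} {d : nat}.
Local Notation V := 'rV[R]_d.
Implicit Types (u : R -> V -> R).

Lemma diff_time_space u (t : R) (x : V) (a : R) (v : V) :
  differentiable (fun z : R * V => u z.1 z.2) (t, x) ->
  'd (fun z : R * V => u z.1 z.2) (t, x) (a, v) =
    a * derive1 (u ^~ x) t + dotv (grad (u t) x) v.
Proof.
set f := (fun z : R * V => u z.1 z.2) => df.
have Et : 'd f (t, x) (1, 0) = derive1 (u ^~ x) t.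
  rewrite -deriveE// derive1E /derive.
  set g1 := (fun h : R => _); set g2 := (fun h : R => _ *: (u _ x - _)).
  suff -> : g1 = g2 by [].
  by apply/funext => h; rewrite /g1 /g2 /f /= scaler0 add0r.
have Ei i : 'd f (t, x) (0, delta_mx 0 i) = grad (u t) x 0 i.
  rewrite -deriveE// mxE /derive.
  set g1 := (fun h : R => _); set g2 := (fun h : R => _ *: (u t _ - _)).
  suff -> : g1 = g2 by [].
  by apply/funext => h; rewrite /g1 /g2 /f /= scaler0 add0r.
have -> : (a, v) = a *: (1, 0) + \sum_(i < d) v 0 i *: ((0 : R), (delta_mx 0 i : V)).
  apply/esym; rewrite [X in _ + X](_ : _ = (0, v)); last first.
    rewrite [v in RHS]row_sum_delta.
    elim/big_ind2: _ => // [a1 b1 a2 b2 -> ->|i _].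
      by congr pair; rewrite addr0.
    by congr pair; rewrite scaler0.
  by congr pair => /=; [rewrite addr0; exact: mulr1|rewrite scaler0 add0r].
rewrite linearD linearZ/= Et linear_sum; congr (_ + _).
by apply: eq_bigr => i _; rewrite linearZ/= Ei mulrC.
Qed.

Lemma is_derive_time_space u (tau : R -> R) (xi : R -> V) (t a : R) (v : V) :
  differentiable (fun z : R * V => u z.1 z.2) (tau t, xi t) ->
  is_derive t 1 tau a -> is_derive t 1 xi v ->
  is_derive t 1 (fun s => u (tau s) (xi s))
    (a * derive1 (u ^~ (xi t)) (tau t) + dotv (grad (u (tau t)) (xi t)) v).
Proof.
move=> df dtau dxi.
have dtau' : differentiable tau t by apply/derivable1_diffP.
have dxi' : differentiable xi t by apply/derivable1_diffP.
have dc : differentiable (fun s => (tau s, xi s)) t by exact: differentiable_pair.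
have dcomp : differentiable ((fun z : R * V => u z.1 z.2) \o (fun s => (tau s, xi s))) t.
  exact: differentiable_comp.
have dd : derivable (fun s => u (tau s) (xi s)) t 1 by exact/derivable1_diffP.
apply: DeriveDef => //.
rewrite (deriveE _ dcomp) diff_comp//= diff_pair//=.
rewrite diff_time_space//.
have -> : 'd tau t 1 = a by rewrite -deriveE// derive_val.
by have -> : 'd xi t 1 = v by rewrite -deriveE// derive_val.
Qed.

Lemma dotv_le_norm (x y : V) : `|dotv x y| <= d%:R * (`|x| * `|y|).
Proof.
rewrite (le_trans (ler_norm_sum _ _ _))//.
rewrite (le_trans (ler_sum _ (fun i _ => _ : _ <= `|x| * `|y|)))//.
  by move=> i _; rewrite normrM ler_pM// coord_le_norm.
by rewrite sumr_const card_ord -[leLHS]mulr_natl.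
Qed.

(** The partial derivatives of u are bounded on a product of [a, b] with a
    cube that contains the path; this product is convex, so that the mean value
    theorem applies on the segment between two points of the graph. *)
Lemma Lipschitz_along_curve u (xi : R -> V) (a b M : R) :
  (forall t x, a <= t <= b ->
     [/\ differentiable (fun z : R * V => u z.1 z.2) (t, x),
         {for (t, x), continuous (fun z : R * V => derive1 (u ^~ z.2) z.1)}
       & {for (t, x), continuous (fun z : R * V => grad (u z.1) z.2)}]) ->
  (forall t, a <= t <= b -> `|xi t| <= M) ->
  exists2 C : R, 0 <= C & forall s t, a <= s -> s <= t -> t <= b ->
    `|u t (xi t) - u s (xi s)| <= C * ((t - s) + `|xi t - xi s|).
Proof.
move=> reg xiM.
pose B := [set x : V | forall i, x 0 i \in `[- M, M]].
have cB : compact B.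
  by apply: (@rV_compact _ _ (fun=> `[- M, M]%classic)) => _; exact: segment_compact.
have cK : compact (`[a, b]%classic `*` B) by apply: compact_setX => //; exact: segment_compact.
have [Ct Ct0 CtP] : exists2 C : R, 0 <= C & forall z, (`[a, b]%classic `*` B) z ->
    `|derive1 (u ^~ z.2) z.1| <= C.
  apply: (@compact_norm_bound R _ R^o _ (fun z : R * V => derive1 (u ^~ z.2) z.1) cK).
  by move=> [t x]; rewrite inE => -[/= tab _]; have [] := reg t x; rewrite in_itv/= in tab.
have [Cx Cx0 CxP] : exists2 C : R, 0 <= C & forall z, (`[a, b]%classic `*` B) z ->
    `|grad (u z.1) z.2| <= C.
  apply: (compact_norm_bound cK).
  by move=> [t x]; rewrite inE => -[/= tab _]; have [] := reg t x; rewrite in_itv/= in tab.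
exists (Ct + d%:R * Cx); first by rewrite addr_ge0 ?mulr_ge0.
move=> s t as_ st tb.
pose tau r := s + r * (t - s).
pose eta r := xi s + r *: (xi t - xi s).
have inB r : 0 <= r <= 1 -> (`[a, b]%classic `*` B) (tau r, eta r).
  move=> /andP[r0 r1]; split => /=; first by rewrite in_itv/= /tau; apply/andP; split; nra.
  have Bx w : a <= w <= b -> B (xi w).
    by move=> wab i; rewrite in_itv/= -ler_norml (le_trans (coord_le_norm _ _))// xiM.
  have Bs := Bx s; have Bt := Bx t; move=> i.
  have := Bs _ i; have := Bt _ i; rewrite !in_itv/= !mxE => /(_ _)/andP Ht /(_ _)/andP Hs.
  have [] := Hs; first by rewrite as_ (le_trans st).
  have [] := Ht; first by rewrite tb (le_trans as_).
  move=> *; apply/andP; split; nra.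
have dtau r : is_derive (r : R) 1 tau (t - s) by exact: is_derive_affine.
have deta r : is_derive (r : R) 1 eta (xi t - xi s) by exact: is_derive_affine.
have drho (r : R) : 0 <= r <= 1 -> is_derive r 1 (fun r : R => u (tau r) (eta r))
   ((t - s) * derive1 (u ^~ (eta r)) (tau r) + dotv (grad (u (tau r)) (eta r)) (xi t - xi s)).
  move=> /inB[/= tab _]; apply: is_derive_time_space => //.
  by have [] := reg (tau r) (eta r) tab.
have rho_cont : {within `[(0 : R), 1], continuous (fun r => u (tau r) (eta r))}.
  apply: derivable_within_continuous => r; rewrite in_itv/= => r01.
  by have [] := drho r r01.
have drho' (r : R) : r \in `](0 : R), 1[ -> is_derive r 1 (fun r : R => u (tau r) (eta r))
   ((t - s) * derive1 (u ^~ (eta r)) (tau r) + dotv (grad (u (tau r)) (eta r)) (xi t - xi s)).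
  by rewrite in_itv/= => /andP[r0 r1]; apply: drho; rewrite !ltW.
have [c c01] := MVT_segment ler01 drho' rho_cont.
have -> : u (tau 1) (eta 1) = u t (xi t).
  by rewrite /tau /eta mul1r scale1r [s + _]addrC [xi s + _]addrC !subrK.
have -> : u (tau 0) (eta 0) = u s (xi s).
  by rewrite /tau /eta mul0r scale0r !addr0.
rewrite subr0 mulr1 => ->.
rewrite in_itv/= in c01; have Bc := inB c c01.
have Bt : `|derive1 (u ^~ (eta c)) (tau c)| <= Ct := CtP _ Bc.
have Bx : `|grad (u (tau c)) (eta c)| <= Cx := CxP _ Bc.
rewrite (le_trans (ler_normD _ _))// normrM ger0_norm ?subr_ge0//.
have := dotv_le_norm (grad (u (tau c)) (eta c)) (xi t - xi s).
have : d%:R * (`|grad (u (tau c)) (eta c)| * `|xi t - xi s|) <= d%:R * Cx * `|xi t - xi s|.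
  by rewrite -mulrA ler_wpM2l// ler_wpM2r.
have : (t - s) * `|derive1 (u ^~ (eta c)) (tau c)| <= (t - s) * Ct.
  by rewrite ler_wpM2l// subr_ge0.
have : 0 <= d%:R * Cx * (t - s) by rewrite !mulr_ge0// subr_ge0.
have : 0 <= Ct * `|xi t - xi s| by rewrite mulr_ge0.
set X1 := `|dotv _ _|; set X2 := `|xi t - xi s|; set X3 := `|derive1 _ _|.
set X4 := d%:R * (`|_| * _); set X5 := d%:R * Cx; lra.
Qed.

End TimeSpaceCalculus.

(** * Differentiation along absolutely continuous curves *)

Lemma within_continuous_cvg_comp (S U : topologicalType) (I : Type) (F : set_system I)
    (A : set S) (f : S -> U) (g : I -> S) (z : S) :
  Filter F -> {within A, continuous f} -> A z -> (forall i, A (g i)) ->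
  g @ F --> z -> (f \o g) @ F --> f z.
Proof.
move=> FF /subspace_continuousP cf Az Ag gz P fP.
apply: (@filterS _ F FF (fun i => A (g i) -> P (f (g i)))).
  by move=> i; apply; exact: Ag.
exact: gz _ (cf z Az P fP).
Qed.

Lemma derive_quotient_cvg (R : realType) (W : normedModType R) (c : R -> W) (t : R) (v : W) :
  is_derive t 1 c v ->
  (fun n => n.+1%:R *: (c (t + n.+1%:R^-1) - c t)) @ \oo --> v.
Proof.
move=> [dc <-]; have step0 : (fun n : nat => n.+1%:R^-1 : R) @ \oo --> (0 : R)^'.
  move=> P P0.
  apply: (@filterS _ \oo _ (fun n : nat => (n.+1%:R^-1 : R) != 0 -> P n.+1%:R^-1)).
    by move=> n; apply; rewrite invr_eq0 pnatr_eq0.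
  exact: (@cvg_harmonic R _ P0).
rewrite [X in X @ _](_ : _ = (fun h : R => h^-1 *: (c (h *: 1 + t) - c t)) \o
    (fun n : nat => n.+1%:R^-1)); first exact: cvg_comp step0 dc.
by apply/funext => n /=; rewrite invrK [_ *: 1]mulr1 [t + _]addrC.
Qed.

Lemma measurable_fun_cvg_continuous (R : realType) (D : set R) (h : nat -> R -> R) (f : R -> R) :
  (forall n, continuous (h n)) ->
  (forall t, D t -> h ^~ t @ \oo --> f t) -> measurable_fun D f.
Proof.
move=> ch hf; apply: (measurable_fun_cvg _ hf) => n.
by apply: measurable_funTS; exact: continuous_measurable_fun.
Qed.

Lemma measurable_fun_is_derive (R : realType) (D : set R) (c f : R -> R) :
  continuous c -> (forall t, D t -> is_derive t 1 c (f t)) ->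
  measurable_fun D f.
Proof.
move=> cc cf.
apply: (@measurable_fun_cvg_continuous _ _
  (fun n t => n.+1%:R *: (c (t + n.+1%:R^-1) - c t))) => //.
  move=> n t; apply: cvgZ; first exact: cvg_cst.
  apply: cvgB; last exact: cc.
  apply: (@cvg_comp _ _ _ (fun t => t + n.+1%:R^-1) c _ (nbhs (t + n.+1%:R^-1))); last exact: cc.
  by apply: cvgD; [exact: cvg_id|exact: cvg_cst].
by move=> t /cf; exact: derive_quotient_cvg.
Qed.

Lemma integrable_cst_segment (R : realType) (s t k : R) :
  lebesgue_measure.-integrable `[s, t] (EFin \o (fun=> k : R)).
Proof.
apply: continuous_compact_integrable; first exact: segment_compact.
by apply: continuous_subspaceT => x; exact: cvg_cst.
Qed.

Section Curves.
Context {R : realType} {d : nat} {T : R}.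
Local Notation V := 'rV[R]_d.
Implicit Types gamma : curve (R := R) d T.

Lemma curve_clamp_continuous gamma : 0 <= T -> continuous (gamma \o clamp 0 T).
Proof.
move=> T0 t; apply/cvgrPdist_lt => e e0.
have [delta delta0 mod] := curve_modulus gamma e0.
near=> s; rewrite /=.
have close : `|clamp 0 T t - clamp 0 T s| < delta.
  by near: s; apply: (@cvgr_dist_lt _ R^o) delta0; exact: clamp_continuous.
have /andP[s0 sT] := clamp_in s T0; have /andP[t0 tT] := clamp_in t T0.
have [st|ts] := leP (clamp 0 T s) (clamp 0 T t).
  by rewrite distrC mod// (le_lt_trans _ close)// ler_norm.
by rewrite mod// ?(ltW ts)// (le_lt_trans _ close)// distrC ler_norm.
Unshelve. all: by end_near. Qed.

Lemma curve_ae_derivable gamma : 0 < T ->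
  {ae lebesgue_measure, forall t, 0 < t < T -> derivable gamma t 1}.
Proof.
move=> T0; have [f fi fg] := curve_ac gamma.
have coord i : {ae lebesgue_measure, forall t, 0 < t < T ->
    derivable (fun t => gamma t 0 i) t 1}.
  have lip s t : 0 <= s -> s <= t -> t <= T ->
      `|gamma t 0 i - gamma s 0 i| <= \int[lebesgue_measure]_(r in `[s, t]) f r.
    move=> s0 st tT; apply: le_trans (fg s t s0 st tT).
    by rewrite distrC; have := coord_le_enorm (gamma s - gamma t) i; rewrite !mxE.
  have [psi [_ _ dpsi]] := @AC_FTC _ 0 T (fun t => gamma t 0 i) f T0 fi lip.
  apply: filterS dpsi; first exact: (ae_filter_ringOfSetsType lebesgue_measure).
  by move=> t h /h[].
have : {ae lebesgue_measure, forall t, forall i, 0 < t < T ->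
    derivable (fun t => gamma t 0 i) t 1}.
  apply: (@filter_forall _ _ _ (almost_everywhere lebesgue_measure)
    (ae_filter_ringOfSetsType lebesgue_measure)) => i.
  exact: coord.
apply: filterS; first exact: (ae_filter_ringOfSetsType lebesgue_measure).
by move=> t h t0T; apply/derivable_mxP => j i; rewrite ord1; exact: h.
Qed.

Lemma curve_bounded gamma : 0 <= T ->
  exists M, forall t, 0 <= t <= T -> `|gamma t| <= M.
Proof.
move=> T0.
have [M _ MP] := @compact_norm_bound R R V `[0, T]%classic (gamma \o clamp 0 T)
  (@segment_compact _ _ _) (fun t _ => @curve_clamp_continuous gamma T0 t).
by exists M => t t0T; have := MP t t0T; rewrite /= clamp_id.
Qed.

(** Away from the end points only: the derivatives of u may blow up at times
    0 and T. *)
Lemma FTC_along_curve gamma (u : R -> V -> R) (a b : R) : 0 < a -> a < b -> b < T ->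
  (forall t x, 0 < t < T ->
     [/\ differentiable (fun z : R * V => u z.1 z.2) (t, x),
         {for (t, x), continuous (fun z : R * V => derive1 (u ^~ z.2) z.1)}
       & {for (t, x), continuous (fun z : R * V => grad (u z.1) z.2)}]) ->
  exists psi : R -> R,
  [/\ lebesgue_measure.-integrable `[a, b] (EFin \o psi),
      u b (gamma b) - u a (gamma a) = \int[lebesgue_measure]_(r in `[a, b]) psi r &
      {ae lebesgue_measure, forall t, a < t < b -> is_derive t 1 (fun t => u t (gamma t)) (psi t)}].
Proof.
move=> a0 ab bT reg; have [f fi fg] := curve_ac gamma.
have T0 : 0 <= T by lra.
have [M gM] := curve_bounded gamma T0.
have abP t : a <= t <= b -> 0 < t < T by move=> /andP[]; lra.
have [C C0 lip] := @Lipschitz_along_curve _ _ u gamma a b M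
  (fun t x tab => reg t x (abP t tab))
  (fun t tab => gM t (ltac:(by have := abP t tab; case/andP=> *; apply/andP; split; apply: ltW))).
have sub s t : a <= s -> t <= b -> `[s, t] `<=` `[0, T].
  by move=> as_ tb; apply: subset_itvScc; rewrite bnd_simp; lra.
have gi s t : a <= s -> t <= b ->
   lebesgue_measure.-integrable `[s, t] (EFin \o (fun r => C * (1 + f r))).
  move=> as_ tb.
  have i1 : lebesgue_measure.-integrable `[s, t] (EFin \o (fun=> 1 : R)).
    exact: integrable_cst_segment.
  have i2 : lebesgue_measure.-integrable `[s, t] (EFin \o f).
    by apply: integrableS fi => //; exact: sub.
  exact: (integrableZl _ C (integrableD _ i1 i2)).
apply: (@AC_FTC _ a b _ (fun r => C * (1 + f r)) ab (gi _ _ (lexx _) (lexx _))).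
move=> s t as_ st tb; rewrite (le_trans (lip s t as_ st tb))//.
have i2 : lebesgue_measure.-integrable `[s, t] (EFin \o f).
  by apply: integrableS fi => //; exact: sub.
have i1 : lebesgue_measure.-integrable `[s, t] (EFin \o (fun=> 1 : R)).
  exact: integrable_cst_segment.
rewrite RintegralZl//; last exact: (integrableD _ i1 i2).
rewrite ler_wpM2l// RintegralD// lerD//.
  rewrite Rintegral_cst//= lebesgue_measure_itv/= lte_fin.
  by case: ltP => h /=; rewrite mul1r//; lra.
rewrite distrC (le_trans (norm_le_enorm _))//.
by apply: fg => //; lra.
Qed.

End Curves.

(** * The verification argument *)

Lemma cvg_nbhs_pair (I : Type) (F : set_system I) (S W : topologicalType)
    (f : I -> S) (g : I -> W) (a : S) (b : W) : Filter F ->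
  f @ F --> a -> g @ F --> b -> (fun i => (f i, g i)) @ F --> (a, b).
Proof.
by move=> FF fa gb; apply: (@cvg_pair _ _ _ F (nbhs a) (nbhs b)).
Qed.

Section Verification.
Context {R : realType} {d : nat} {T : R}.
Local Notation V := 'rV[R]_d.
Local Notation mu := (@lebesgue_measure R).
Hypothesis T0 : 0 < T.
Variables (l : R -> V -> V -> R) (gT : V -> R) (u : R -> V -> R).
Local Notation H := (fun t x => hamiltonian (l t x)).
Hypothesis lc : {within [set z : R * V * V | 0 <= z.1.1 <= T],
  continuous (fun z : R * V * V => l z.1.1 z.1.2 z.2)}.
Hypothesis sol : classical_solution T H gT u.

Let T0' : 0 <= T := ltW T0.

Lemma HJ_hamiltonian t x : 0 < t < T ->
  H t x (- grad (u t) x) = (derive1 (u ^~ x) t)%:E.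
Proof.
case: sol => _ _ HJ _ /(HJ t x).
case: (H t x _) => [r| |] //=.
by rewrite -EFinD => -[] /eqP; rewrite addrC subr_eq0 => /eqP ->.
Qed.

Lemma value_clamp_continuous (xi : R -> V) : continuous (xi \o clamp 0 T) ->
  continuous (fun s => u (clamp 0 T s) (xi (clamp 0 T s))).
Proof.
case: sol => cu _ _ _ cxi s.
apply: (@within_continuous_cvg_comp _ _ _ (nbhs s) _ (fun z : R * V => u z.1 z.2)
  (fun s => (clamp 0 T s, xi (clamp 0 T s))) (clamp 0 T s, xi (clamp 0 T s))) => //=.
- exact: clamp_in.
- by move=> i; exact: clamp_in.
- by apply: cvg_nbhs_pair; [exact: clamp_continuous|exact: cxi].
Qed.

Lemma lagrangian_cvg (I : Type) (F : set_system I) (xi v : I -> V) (c : I -> R)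
    (c0 : R) (x0 v0 : V) : Filter F ->
  0 <= c0 <= T -> (forall i, 0 <= c i <= T) -> c @ F --> c0 -> xi @ F --> x0 -> v @ F --> v0 ->
  (fun i => l (c i) (xi i) (v i)) @ F --> l c0 x0 v0.
Proof.
move=> FF c0T cT cc cxi cv.
apply: (@within_continuous_cvg_comp _ _ _ F _ (fun z : R * V * V => l z.1.1 z.1.2 z.2)
  (fun i => (c i, xi i, v i)) (c0, x0, v0)) => //=.
by apply: cvg_nbhs_pair => //; exact: cvg_nbhs_pair.
Qed.

Section AlongCurve.
Variable gamma : curve (R := R) d T.
Local Notation U := (fun t => u t (gamma t)).
Local Notation gamma' := (derive1 gamma).

(* psi is the derivative of U, and psi - q the gap in the Fenchel inequality
   along gamma. *)
Let psi t := 1 * derive1 (u ^~ (gamma t)) t + dotv (grad (u t) (gamma t)) (gamma' t).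
Let q t := - l t (gamma t) (gamma' t).
Let qp t := Num.max (q t) 0.
Let qn t := Num.max (- q t) 0.

Let is_derive_U t : 0 < t < T -> derivable gamma t 1 -> is_derive t 1 U (psi t).
Proof.
move=> t0T dg; case: sol => _ /(_ t (gamma t) t0T)[du _ _] _ _.
have dgamma : is_derive t 1 gamma (gamma' t).
  by apply: DeriveDef; [exact: dg|rewrite derive1E].
exact: (@is_derive_time_space _ _ u id gamma t 1 (gamma' t) du (is_derive_id _ _) dgamma).
Qed.

Let gap_ge0 t : 0 < t < T -> 0 <= psi t - q t.
Proof.
move=> t0T; have HJ := HJ_hamiltonian (gamma t) t0T.
have := @le_hamiltonian _ _ (l t (gamma t)) (- grad (u t) (gamma t)) (gamma' t).
rewrite /= in HJ; rewrite HJ => /(_ isT) /=.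
by rewrite dotvNl /psi /q; lra.
Qed.

(** Along gamma, d/dt u(t, gamma_t) + l(t, gamma_t, gamma'_t) is the gap in
    the Fenchel inequality, hence nonnegative. Its integral over [a, b] in the
    open interval is the cost on [a, b] plus the increment of u. If the cost of
    gamma is at most u(0, gamma_0), letting [a, b] grow to [0, T] shows that the
    gap has integral zero, so that gamma' is optimal almost everywhere. *)
Lemma verification : (cost l gT gamma <= (u 0 (gamma 0))%:E)%E ->
  {ae mu, forall t, 0 < t < T -> derivable gamma t 1 /\
    dotv (- grad (u t) (gamma t)) (gamma' t) - l t (gamma t) (gamma' t) =
    fine (H t (gamma t) (- grad (u t) (gamma t)))}.
Proof.
move=> cost_le.
have [N [mN N0 ND]] := curve_ae_derivable gamma T0.
(* All integrals are taken over the set D of full measure on which gamma has a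
   derivative, where the integrands are limits of continuous functions. *)
pose D : set (measurableTypeR R) := `]0, T[ `\` N.
have mD : measurable D by apply: measurableD.
have DT t : D t -> 0 < t < T by move=> [/=]; rewrite in_itv.
have dg t : D t -> derivable gamma t 1.
  move=> Dt; apply: contrapT => nd; case: Dt => /= + Nt; rewrite in_itv/= => t0T.
  by apply: Nt; apply: ND => /= /(_ t0T).
have cgamma := @curve_clamp_continuous _ _ _ gamma T0'.
have cU := @value_clamp_continuous gamma cgamma.
have clampD t : D t -> clamp 0 T t = t.
  by move=> /DT/andP[t0 tT]; rewrite clamp_id// !ltW.
have near_clamp t : D t -> \forall s \near t, clamp 0 T s = s.
  move=> /DT/andP[t0 tT]; near=> s; rewrite clamp_id//; apply/andP; split; apply: ltW.
    by near: s; exact: lt_nbhsr.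
  by near: s; exact: lt_nbhsl.
have mpsi : measurable_fun D psi.
  apply: (measurable_fun_is_derive cU) => t Dt.
  apply: near_eq_is_derive (is_derive_U (DT t Dt) (dg t Dt)).
  by apply: filterS (near_clamp t Dt) => s /= ->.
have mq : measurable_fun D q.
  apply: (@measurable_fun_cvg_continuous _ _ (fun n s => - l (clamp 0 T s)
    (gamma (clamp 0 T s)) (n.+1%:R *: (gamma (clamp 0 T (s + n.+1%:R^-1)) -
                                        gamma (clamp 0 T s))))).
    move=> n s; apply: cvgN; apply: lagrangian_cvg.
    - exact: clamp_in.
    - by move=> i; exact: clamp_in.
    - exact: clamp_continuous.
    - exact: cgamma.
    - apply: cvgZ; first exact: cvg_cst.
      apply: cvgB; last exact: cgamma.
      apply: (@cvg_comp _ _ _ (fun t => t + n.+1%:R^-1) (gamma \o clamp 0 T) _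
        (nbhs (s + n.+1%:R^-1))); last exact: cgamma.
      by apply: cvgD; [exact: cvg_id|exact: cvg_cst].
  move=> t Dt; apply: cvgN; rewrite /= clampD//.
  have /andP[t0 tT] := DT t Dt.
  apply: lagrangian_cvg.
  - by rewrite !ltW.
  - by move=> _; rewrite !ltW.
  - exact: cvg_cst.
  - exact: cvg_cst.
  - have : is_derive t 1 (gamma \o clamp 0 T) (gamma' t).
      apply: near_eq_is_derive (_ : is_derive t 1 gamma (gamma' t)).
        by apply: filterS (near_clamp t Dt) => s /= ->.
      by apply: DeriveDef; [exact: dg|rewrite derive1E].
    by move=> /derive_quotient_cvg; rewrite /= clampD.
have mqp : measurable_fun D qp by apply: measurable_maxr => //; exact: measurable_cst.
have mqn : measurable_fun D qn.
  by apply: measurable_maxr; [exact: measurableT_comp|exact: measurable_cst].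
have qpn t : q t = qp t - qn t.
  by rewrite /qp /qn; case: (leP (q t) 0) => h; case: (leP (- q t) 0) => h'; lra.
have qp0 t : 0 <= qp t by rewrite /qp le_max lexx orbT.
have qn0 t : 0 <= qn t by rewrite /qn le_max lexx orbT.
pose Bp := (\int[mu]_(t in D) (qp t)%:E)%E.
pose Bn := (\int[mu]_(t in D) (qn t)%:E)%E.
pose Delta := U T - U 0.
have intq : (\int[mu]_(t in `[0%R, T]) (q t)%:E = Bp - Bn)%E.
  rewrite (@integral_null _ _ _ mu _ (N `|` [set 0] `|` [set T])); first last.
  - apply: measure_negligible; first by do 2!apply: measurableU => //.
    apply: negligibleU; first apply: negligibleU.
      by exists N; split => //; exact: subset_refl.
      by apply/negligibleP => //; exact: lebesgue_measure_set1.
    by apply/negligibleP => //; exact: lebesgue_measure_set1.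
  - by do 2!apply: measurableU => //.
  have -> : `[0, T] `\` (N `|` [set 0] `|` [set T]) = D.
    apply/seteqP; split=> t /=; rewrite /D /= !in_itv/=.
      move=> [/andP[t0 tT] nt]; split; last by move=> Nt; apply: nt; left; left.
      rewrite lt_neqAle t0 andbT lt_neqAle tT andbT; apply/andP; split.
        by apply/eqP => E; apply: nt; left; right.
      by apply/eqP => E; apply: nt; right.
    move=> [/andP[t0 tT] nt]; split; first by rewrite !ltW.
    by move=> [[//|E]|E]; [rewrite E ltxx in t0|rewrite E ltxx in tT].
  rewrite integralE; congr (_ - _)%E; apply: eq_integral => t _.
    by rewrite funeposE /= -EFin_max.
  by rewrite funenegE /= -EFin_max.
have Bp0 : (0 <= Bp)%E by apply: integral_ge0 => t _; rewrite lee_fin.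
have Bn0 : (0 <= Bn)%E by apply: integral_ge0 => t _; rewrite lee_fin.
have Delta_le : (Delta%:E <= Bp - Bn)%E.
  move: cost_le; rewrite /cost.
  rewrite [X in (- X + _)%E](_ : _ = Bp - Bn)%E; last exact: intq.
  have UT : gT (gamma T) = U T by case: sol => _ _ _ ->.
  rewrite UT /Delta.
  move: (Bp - Bn)%E => [r| |]//=.
    by rewrite !lee_fin; lra.
  by rewrite leey.
(* Only the negative part of q is integrable a priori, thanks to the convention
   on infinite costs. This is why psi + qn, which is the gap plus qp, is
   integrated below: it is nonnegative and monotone convergence applies. *)
have Bnfin : (Bn < +oo)%E.
  rewrite ltNge leye_eq; apply/negP => /eqP Bnoo.
  by move: Delta_le; rewrite Bnoo /=; case: (Bp).
have iqn : mu.-integrable D (EFin \o qn).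
  apply/integrableP; split; first exact/measurable_EFinP.
  by under eq_integral do rewrite /= ger0_norm//.
(* The shift by 3 ensures that a n < b n already for n = 0. *)
pose a n : R := T / n.+3%:R.
pose b n : R := T - a n.
have a_gt0 n : 0 < a n by rewrite divr_gt0.
have a_lt n : a n < T / 2.
  by rewrite /a ltr_pM2l// ltf_pV2 ?posrE// ltr_nat.
have ab n : a n < b n by have := a_lt n; rewrite /b; lra.
have bT n : b n < T by have := a_gt0 n; rewrite /b; lra.
have a_homo n m : (n <= m)%N -> a m <= a n.
  by move=> nm; rewrite /a ler_pM2l// lef_pV2 ?posrE// ler_nat !ltnS.
have a_cvg : a @ \oo --> (0 : R).
  apply/cvgrPdist_lt => e e0; near=> n.
  rewrite sub0r normrN gtr0_norm// /a ltr_pdivrMr// mulrC -ltr_pdivrMr//.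
  apply: (@lt_trans _ _ n%:R); last by rewrite ltr_nat ltnS !leqW.
  by near: n; exact: nbhs_infty_gtr.
have b_cvg : b @ \oo --> T.
  have h : (fun n => T - a n) @ \oo --> T - 0 by apply: cvgB => //; exact: cvg_cst.
  by rewrite subr0 in h.
pose Dn n : set (measurableTypeR R) := D `&` `[a n, b n].
have mDn n : measurable (Dn n) by exact: measurableI.
have DnD n : Dn n `<=` D by exact: subIsetl.
have nd_Dn : nondecreasing_seq Dn.
  move=> n m nm; apply/subsetPset => t [Dt /=]; rewrite !in_itv/= => /andP[ant tbn].
  split => //=; rewrite in_itv/= (le_trans (a_homo _ _ nm))//=.
  by rewrite (le_trans tbn)// /b lerD2l lerN2 a_homo.
have Dn_cover : \bigcup_n Dn n = D.
  apply/seteqP; split=> [t [n _ []]//|t Dt].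
  have /andP[t0 tT] := DT t Dt.
  have small e : 0 < e -> \forall n \near \oo, a n < e.
    by move=> e0; apply: (cvgr_lt _ a_cvg).
  near \oo => n; exists n => //; split => //=; rewrite in_itv/=; apply/andP; split.
    by apply/ltW; near: n; exact: small.
  rewrite /b lerBrDl -lerBrDr; apply/ltW; near: n; apply: small; lra.
have int_Dn n : (\int[mu]_(t in Dn n) (psi t + qn t)%:E =
    (U (b n) - U (a n))%:E + \int[mu]_(t in Dn n) (qn t)%:E)%E.
  have [f [fi UE df]] := @FTC_along_curve _ _ _ gamma u (a n) (b n) (a_gt0 n) (ab n) (bT n)
    (fun t x t0T => let: And4 _ reg _ _ := sol in reg t x t0T).
  have iqnn : mu.-integrable (Dn n) (EFin \o qn).
    exact: (integrableS mD (mDn n) (@DnD n) iqn).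
  have ifn : mu.-integrable (Dn n) (EFin \o f).
    by apply: (integrableS _ (mDn n) _ fi) => //; exact: subIsetr.
  have f_psi : ae_eq mu (Dn n) (EFin \o f) (EFin \o psi).
    have ends : {ae mu, forall t, t != a n /\ t != b n}.
      exists ([set a n] `|` [set b n]); split.
      - exact: measurableU.
      - apply: measure_negligible; first exact: measurableU.
        by apply: negligibleU; apply/negligibleP => //; exact: lebesgue_measure_set1.
      - by move=> t /= /not_andP[]/negP; rewrite negbK => /eqP; [left|right].
    apply: filterS2 df ends; first exact: (ae_filter_ringOfSetsType mu).
    move=> t dt [ta tb] [Dt /=]; rewrite in_itv/= => /andP[at_ tb_].
    congr (_%:E).
    have d1 : is_derive t 1 U (f t).
      by apply: dt; rewrite lt_neqAle eq_sym ta at_ lt_neqAle tb tb_.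
    have d2 := is_derive_U (DT t Dt) (dg t Dt).
    by rewrite -[LHS](@derive_val _ _ _ _ _ _ _ d1) (@derive_val _ _ _ _ _ _ _ d2).
  have mpsin : measurable_fun (Dn n) (EFin \o psi).
    by apply/measurable_EFinP; exact: measurable_funS mpsi.
  have mf : measurable_fun (Dn n) (EFin \o f) by exact: (measurable_int mu ifn).
  have psi_f : (\int[mu]_(t in Dn n) (psi t)%:E = \int[mu]_(t in Dn n) (f t)%:E)%E.
    exact/esym/(@ae_eq_integral _ (measurableTypeR R) R mu (Dn n)
      (EFin \o psi) (EFin \o f) (mDn n) mf mpsin f_psi).
  have ipsi : mu.-integrable (Dn n) (EFin \o psi).
    apply/integrableP; split => //.
    have /integrableP[_] := ifn; congr (_ < _)%E.
    apply: (@ae_eq_integral _ (measurableTypeR R) R mu (Dn n)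
      (abse \o (EFin \o psi)) (abse \o (EFin \o f)) (mDn n)).
    - exact: measurableT_comp.
    - exact: measurableT_comp.
    - exact: ae_eq_abse.
  transitivity ((\int[mu]_(t in Dn n) (psi t)%:E + \int[mu]_(t in Dn n) (qn t)%:E)%E).
    exact: (integralD (mDn n) ipsi iqnn).
  rewrite psi_f UE /Rintegral fineK; last exact: (integrable_fin_num _ fi).
  congr (_ + _)%E; rewrite [RHS](integral_null _ _ mN N0); congr (integral mu _ _).
  rewrite /Dn /D; apply/seteqP; split=> t /=; rewrite !in_itv/=; first by move=> [[_ ?] ?].
  move=> [/andP[at_ tb] Nt]; rewrite at_ tb; split => //; split => //.
  by rewrite (lt_le_trans (a_gt0 n) at_) (le_lt_trans tb (bT n)).
have lhs : (\int[mu]_(t in Dn n) (psi t + qn t)%:E @[n --> \oo] -->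
    \int[mu]_(t in D) (psi t + qn t)%:E)%E.
  rewrite -Dn_cover; apply: ge0_nondecreasing_set_cvg_integral => //.
  - move=> n; apply/measurable_EFinP; apply: measurable_funD.
      exact: measurable_funS mpsi.
    exact: measurable_funS mqn.
  - move=> n t /DnD Dt; rewrite lee_fin; have := gap_ge0 (DT t Dt).
    by have := qp0 t; rewrite qpn; lra.
have rhs : ((U (b n) - U (a n))%:E + \int[mu]_(t in Dn n) (qn t)%:E @[n --> \oo] -->
    Delta%:E + Bn)%E.
  have UD : (fun n => U (b n) - U (a n)) @ \oo --> Delta.
    have -> : (fun n => U (b n) - U (a n)) = (fun n =>
        u (clamp 0 T (b n)) (gamma (clamp 0 T (b n))) -
        u (clamp 0 T (a n)) (gamma (clamp 0 T (a n)))).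
      apply/funext => n; have := a_gt0 n; have := ab n; have := bT n => b1 b2 b3.
      by rewrite !clamp_id//; apply/andP; split; lra.
    have -> : Delta = u (clamp 0 T T) (gamma (clamp 0 T T)) -
        u (clamp 0 T 0) (gamma (clamp 0 T 0)) by rewrite !clamp_id ?lexx ?T0'.
    pose Uc s := u (clamp 0 T s) (gamma (clamp 0 T s)).
    apply: (@cvgB _ R^o _ _ _ (Uc \o b) (Uc \o a)).
      exact: (@cvg_comp _ _ _ b Uc _ (nbhs T) _ b_cvg (cU T)).
    exact: (@cvg_comp _ _ _ a Uc _ (nbhs 0) _ a_cvg (cU 0)).
  apply: cvgeD => //.
  - by apply: cvg_EFin => //; exact: nearW.
  - rewrite /Bn -Dn_cover; apply: ge0_nondecreasing_set_cvg_integral => //.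
    + by move=> n; apply/measurable_EFinP; exact: measurable_funS mqn.
    + by move=> n t _; rewrite lee_fin.
have total : (\int[mu]_(t in D) (psi t + qn t)%:E = Delta%:E + Bn)%E.
  rewrite -(cvg_lim _ lhs)// -(cvg_lim _ rhs)//; congr (lim (_ @ \oo)).
  by apply/funext => n; exact: int_Dn.
have mgap : measurable_fun D (fun t => psi t - q t) by exact: measurable_funB.
have gapD : (\int[mu]_(t in D) (psi t + qn t)%:E =
    \int[mu]_(t in D) (psi t - q t)%:E + Bp)%E.
  rewrite /Bp -ge0_integralD//.
  - by apply: eq_integral => t _; rewrite -EFinD qpn; congr (_%:E); ring.
  - by move=> t Dt; rewrite lee_fin gap_ge0// DT.
  - exact/measurable_EFinP.
  - by move=> t _; rewrite lee_fin.
  - exact/measurable_EFinP.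
have gap0 : (0 <= \int[mu]_(t in D) (psi t - q t)%:E)%E.
  by apply: integral_ge0 => t Dt; rewrite lee_fin gap_ge0// DT.
have gap_eq0 : (\int[mu]_(t in D) `|(psi t - q t)%:E| = 0)%E.
  transitivity (\int[mu]_(t in D) (psi t - q t)%:E)%E.
    by apply: eq_integral => t; rewrite inE => Dt; rewrite gee0_abs// lee_fin gap_ge0// DT.
  apply/eqP; rewrite eq_le gap0 andbT.
  move: gapD gap0 Bp0 Bn0 Delta_le Bnfin; rewrite total.
  clear -T0; move: (\int[mu]_(t in D) (psi t - q t)%:E)%E Bp Bn Delta.
  move=> [x| |] [y| |] [z| |] Dlt //=.
  rewrite -!EFinD => -[] E; rewrite !lee_fin; lra.
have mgapE : measurable_fun D (EFin \o (fun t => psi t - q t)) by exact/measurable_EFinP.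
have gap_ae : {ae mu, forall t, D t -> (psi t - q t)%:E = 0%E}.
  exact: (ae_eq_integral_abs mu mD mgapE).1 gap_eq0.
have offN : {ae mu, forall t, ~ N t}.
  by exists N; split => // t /= /contrapT.
apply: filterS2 offN gap_ae.
move=> t Nt gap_t t0T.
have Dt : D t by split => //=; rewrite in_itv.
split; first exact: dg.
have HJ := HJ_hamiltonian (gamma t) t0T; rewrite /= in HJ; rewrite HJ /= dotvNl.
by have [] := gap_t Dt; rewrite /psi /q; lra.
Unshelve. all: by end_near. Qed.

End AlongCurve.
End Verification.

(** * Uniqueness of minimizers *)

Section Curves.
Context {R : realType} {d : nat} {T : R}.
Local Notation V := 'rV[R]_d.
Local Notation mu := (@lebesgue_measure R).

Lemma curve_eq (g1 g2 : curve (R := R) d T) : eq_on_time T g1 g2 -> g1 = g2.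
Proof.
case: g1 g2 => [f1 ac1 out1] [f2 ac2 out2] /= E.
have F : f1 = f2.
  apply/funext => t; case: (boolP (0 <= t <= T)) => tT; first exact: E.
  by rewrite out1// out2.
by subst f2; congr MkCurve; exact: Prop_irrelevance.
Qed.

Lemma is_derive_coord (xi : R -> V) (t : R) (v : V) i :
  is_derive t 1 xi v -> is_derive t 1 (fun t => xi t 0 i) (v 0 i).
Proof.
move=> [dxi <-]; apply: DeriveDef; first by move/derivable_mxP : dxi; exact.
by rewrite derive_mx// mxE.
Qed.

Lemma within_coord (A : set R) (xi : R -> V) i : {within A, continuous xi} ->
  {within A, continuous (fun t => xi t 0 i)}.
Proof.
move=> cxi t.
exact: (@continuous_comp _ _ _ (xi : subspace A -> V) (fun v : V => v 0 i) t (cxi t)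
  (@coord_continuous _ _ _ _ _ _)).
Qed.

Lemma curve_of_C1_path (xi w : R -> V) :
  {within `[0, T], continuous xi} -> {within `[0, T], continuous w} ->
  (forall t, 0 < t < T -> is_derive t 1 xi (w t)) ->
  exists gamma : curve (R := R) d T, eq_on_time T gamma xi.
Proof.
move=> cxi cw dxi.
have [M M0 wM] : exists2 M : R, 0 <= M & forall t, 0 <= t <= T -> `|w t| <= M.
  have [M [_ MP]] := compact_bounded (continuous_compact cw (@segment_compact _ _ _)).
  exists (`|M| + 1); first by rewrite addr_ge0.
  move=> t tT; apply: MP; first by rewrite (le_lt_trans (ler_norm M))// ltrDl.
  by exists t.
have lip s t : 0 <= s -> s <= t -> t <= T -> Defs.edist (xi s) (xi t) <= d.+1%:R * M * (t - s).
  move=> s0 st tT; rewrite (le_trans (enorm_le_norm _))// -mulrA ler_wpM2l//.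
  apply: norm_le_coord => [|i]; first by rewrite mulr_ge0// subr_ge0.
  have inT r : r \in `]s, t[ -> 0 < r < T.
    by rewrite in_itv/= => /andP[sr rt]; rewrite (le_lt_trans s0 sr) (lt_le_trans rt tT).
  have dcoord (r : R) : r \in `]s, t[ -> is_derive r 1 (fun t => xi t 0 i) (w r 0 i).
    by move=> /inT rT; apply: is_derive_coord; exact: dxi.
  have ccoord : {within `[s, t], continuous (fun t => xi t 0 i)}.
    apply: within_coord; apply: continuous_subspaceW cxi.
    by apply: subset_itvScc; rewrite bnd_simp.
  have [c c_st E] := MVT_segment st dcoord ccoord.
  rewrite !mxE distrC E normrM [X in _ * X]ger0_norm ?subr_ge0// ler_wpM2r ?subr_ge0//.
  rewrite (le_trans (coord_le_norm _ _))// wM//; move: c_st; rewrite in_itv/= => /andP[sc ct].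
  by rewrite (le_trans s0 sc) (le_trans ct tT).
pose g t := if 0 <= t <= T then xi t else 0.
have gE t : 0 <= t <= T -> g t = xi t by move=> h; rewrite /g h.
have gac : abs_continuous Defs.edist T g.
  exists (fun=> d.+1%:R * M).
    exact: integrable_cst_segment.
  move=> s t s0 st tT; rewrite !gE ?s0 ?(le_trans st tT) ?(le_trans s0 st)//.
  rewrite (le_trans (lip s t s0 st tT))// Rintegral_cst//= lebesgue_measure_itv/= lte_fin.
  by case: ltP => h //=; rewrite ler_wpM2l// ?mulr_ge0// subr_le0.
have gout t : ~~ (0 <= t <= T) -> g t = 0 by move=> /negPf h; rewrite /g h.
by exists (MkCurve gac gout).
Qed.

Hypothesis T0 : 0 < T.
Variables (l : R -> V -> V -> R) (gT : V -> R) (u : R -> V -> R).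
Local Notation H := (fun t x => hamiltonian (l t x)).
Hypothesis lc : {within [set z : R * V * V | 0 <= z.1.1 <= T],
  continuous (fun z : R * V * V => l z.1.1 z.1.2 z.2)}.
Hypothesis sol : classical_solution T H gT u.

Lemma lagrangian_continuous_velocity t x v : 0 <= t <= T -> {for v, continuous (l t x)}.
Proof.
move=> tT; apply: (@lagrangian_cvg _ _ _ _ lc _ (nbhs v) (fun=> x) id (fun=> t)) => //.
- exact: cvg_cst.
- exact: cvg_cst.
Qed.

(** The equality case of the Fenchel inequality: the cost density is minus the
    derivative of u along the curve. *)
Lemma cost_optimal_curve (gamma : curve (R := R) d T) (w : R -> V) :
  {within `[0, T], continuous w} ->
  (forall t, 0 < t < T -> is_derive t 1 gamma (w t) /\
     dotv (- grad (u t) (gamma t)) (w t) - l t (gamma t) (w t) =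
     fine (H t (gamma t) (- grad (u t) (gamma t)))) ->
  cost l gT gamma = (u 0 (gamma 0))%:E.
Proof.
move=> cw opt; have T0' := ltW T0.
have cgamma := @curve_clamp_continuous _ _ _ gamma T0'.
pose Uc s := u (clamp 0 T s) (gamma (clamp 0 T s)).
have cU : continuous Uc := @value_clamp_continuous _ _ _ T0 _ _ _ sol gamma cgamma.
have cwc : continuous (w \o clamp 0 T).
  move=> s; apply: (@within_continuous_cvg_comp _ _ _ (nbhs s) `[0, T]%classic w (clamp 0 T)).
  - exact: cw.
  - by rewrite /= in_itv/=; exact: clamp_in.
  - by move=> i; rewrite /= in_itv/=; exact: clamp_in.
  - exact: clamp_continuous.
pose k s := - l (clamp 0 T s) (gamma (clamp 0 T s)) (w (clamp 0 T s)).
have ck : continuous k.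
  move=> s; apply: cvgN; apply: (lagrangian_cvg lc).
  - exact: clamp_in.
  - by move=> i; exact: clamp_in.
  - exact: clamp_continuous.
  - exact: cgamma.
  - exact: cwc.
have dU t : 0 < t < T -> is_derive t 1 Uc (k t).
  move=> tT; have [dg max_w] := opt t tT; have /andP[t0 tT'] := tT.
  have [_ reg _ _] := sol; have [du _ _] := reg t (gamma t) tT.
  have := @is_derive_time_space _ _ u id gamma t 1 (w t) du _ dg.
  have -> : 1 * derive1 (u ^~ (gamma t)) t + dotv (grad (u t) (gamma t)) (w t) = k t.
    rewrite /k clamp_id ?(ltW t0) ?(ltW tT')//.
    by move: max_w; rewrite (HJ_hamiltonian sol _ tT) /= dotvNl; lra.
  move=> /(_ (is_derive_id _ _)); apply: near_eq_is_derive.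
  near=> s; rewrite /Uc clamp_id//; apply/andP; split; apply: ltW.
    by near: s; exact: lt_nbhsr.
  by near: s; exact: lt_nbhsl.
have intk : (\int[mu]_(s in `[0%R, T]) (k s)%:E = (Uc T)%:E - (Uc 0)%:E)%E.
  apply: continuous_FTC2 => //.
  - exact: continuous_subspaceT.
  - split.
    + by move=> t; rewrite in_itv/= => /dU[].
    + by apply: cvg_at_right_filter; exact: cU.
    + by apply: cvg_at_left_filter; exact: cU.
  - by move=> t; rewrite in_itv/= => /dU h; rewrite derive1E derive_val.
pose bdry : set (measurableTypeR R) := [set (0 : R)] `|` [set T].
have mbdry : measurable bdry by exact: measurableU.
have bdry0 : mu bdry = 0%E.
  apply: measure_negligible => //.
  by apply: negligibleU; apply/negligibleP => //; exact: lebesgue_measure_set1.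
rewrite /cost.
have -> : (\int[mu]_(s in `[0%R, T]) (- l s (gamma s) (derive1 gamma s))%:E =
           \int[mu]_(s in `[0%R, T]) (k s)%:E)%E.
  rewrite (integral_null _ _ mbdry bdry0) [RHS](integral_null _ _ mbdry bdry0).
  apply: eq_integral => t; rewrite inE /= in_itv/= => -[/andP[t0 tT] tn].
  have tT0 : 0 < t < T.
    rewrite lt_neqAle t0 andbT lt_neqAle tT andbT; apply/andP; split.
      by apply/eqP => E; apply: tn; left.
    by apply/eqP => E; apply: tn; right.
  have [[dg dgw] _] := opt t tT0.
  by rewrite derive1E dgw /k clamp_id// t0.
have [_ _ _ uT] := sol.
rewrite intk -uT /Uc !clamp_id ?lexx ?T0'//.
by rewrite -EFinB -EFinN -EFinD; congr (_%:E); lra.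
Unshelve. all: by end_near. Qed.

End Curves.

Section UniqueMinimizer.
Context {R : realType} {d : nat} {T : R}.
Local Notation V := 'rV[R]_d.

(** The only candidate is the integral curve of the optimal feedback: its
    velocity maximizes the Hamiltonian, so it costs u(0, x), and a minimizer, which
    costs no more, must follow the same feedback. *)
Lemma unique_minimizer (l : R -> V -> V -> R) (gT : V -> R) : 0 < T ->
  {within [set z : R * V * V | 0 <= z.1.1 <= T],
    continuous (fun z : R * V * V => l z.1.1 z.1.2 z.2)} ->
  HJ_hypothesis T l gT ->
  forall x, exists gamma : @Gamma R d T, minimizers l gT x `<=` [set gamma].
Proof.
move=> T0 lc [u [sol _ hreg [Phi flow]]] x.
have [Phi0 cPhi [w cw dPhi] Phi_unique] := flow x.
have [xi xiE] := curve_of_C1_path cPhi cw (fun t tT => (dPhi t tT).1).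
have xi_x : xi 0 = x by rewrite xiE// lexx ltW.
have argmax t : 0 < t < T -> let p := - grad (u t) (xi t) in
    w t = grad (fun q => fine (hamiltonian (l t (xi t)) q)) p.
  move=> tT; have /andP[t0 t1] := tT.
  by rewrite /= (dPhi t tT).2 !xiE// !ltW.
have cost_xi : cost l gT xi = (u 0 x)%:E.
  rewrite -xi_x; apply: (cost_optimal_curve T0 lc sol cw) => t tT.
  have /andP[t0 t1] := tT; have [fin dif] := hreg t (xi t) tT; split.
    apply: near_eq_is_derive (dPhi t tT).1.
    near=> s; apply/esym/xiE; apply/andP; split; apply: ltW.
      by near: s; exact: lt_nbhsr.
    by near: s; exact: lt_nbhsl.
  rewrite argmax//; apply: maximizer_exists => //.
  by apply: (lagrangian_continuous_velocity lc); rewrite !ltW.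
exists xi => gamma [gamma0 gamma_min].
have cost_gamma : (cost l gT gamma <= (u 0 ((gamma : curve d T) 0))%:E)%E.
  by rewrite gamma0 -cost_xi; apply: gamma_min.
apply: curve_eq => t tT; rewrite xiE//; apply: Phi_unique => //.
have := verification T0 lc sol cost_gamma.
apply: filterS; first exact: (ae_filter_ringOfSetsType lebesgue_measure).
move=> s h sT; have [dg gmax] := h sT; split => //.
have [fin dif] := hreg s ((gamma : curve d T) s) sT.
exact: maximizer_unique gmax.
Unshelve. all: by end_near. Qed.

End UniqueMinimizer.

(** * The Wasserstein distance *)

Section Wasserstein.
Context {R : realType} {d : nat}.
Local Notation BV := (borel R d).

Lemma W2_P2_eq (mu nu mu' nu' : P2 R d) : P2_eq mu mu' -> P2_eq nu nu' ->
  W2 mu nu = W2 mu' nu'.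
Proof.
move=> Emu Enu; rewrite /W2; congr (Num.sqrt (fine (ereal_inf _))).
suff -> : coupling mu nu = coupling mu' nu' by [].
apply/funext => pi; apply/propext; split=> -[h1 h2]; split=> B mB.
- by rewrite h1// Emu.
- by rewrite h2// Enu.
- by rewrite h1// Emu.
- by rewrite h2// Enu.
Qed.

Lemma measurable_coord i : measurable_fun setT (fun x : BV => (x : 'rV[R]_d) 0 i).
Proof.
apply: (measurability _ (RGenOpens.measurableE R)) => _ [_ [a [b ->] <-]].
rewrite setTI; apply: sub_gen_smallest.
apply: open_comp; last exact: interval_open.
by move=> x _; exact: coord_continuous.
Qed.

Lemma measurable_sqr_edist :
  measurable_fun setT (fun z : BV * BV => ((Defs.edist z.1 z.2 : R) ^+ 2)%:E).
Proof.
apply/measurable_EFinP.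
under eq_fun do rewrite /Defs.edist /enorm sqr_sqrtr ?dotv_ge0// /dotv.
apply: measurable_sum => i.
have mc : measurable_fun setT (fun z : BV * BV => ((z.1 : 'rV[R]_d) - z.2) 0 i).
  under eq_fun do rewrite !mxE.
  apply: measurable_funB.
  - exact: (measurableT_comp (measurable_coord i)).
  - exact: (measurableT_comp (measurable_coord i)).
exact: measurable_funM.
Qed.

(** Exchange the factors of each coupling. *)
Lemma W2_sym (mu nu : P2 R d) : W2 mu nu = W2 nu mu.
Proof.
rewrite /W2; congr (Num.sqrt (fine (ereal_inf _))).
suff sub (m n : P2 R d) :
    [set (\int[pi]_z ((Defs.edist z.1 z.2) ^+ 2)%:E)%E | pi in coupling m n] `<=`
    [set (\int[pi]_z ((Defs.edist z.1 z.2) ^+ 2)%:E)%E | pi in coupling n m].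
  by apply/seteqP; split; exact: sub.
move=> _ [pi [h1 h2] <-].
have msw : measurable_fun setT (fun z : BV * BV => (z.2, z.1)).
  by apply: measurable_fun_pair; [exact: measurable_snd|exact: measurable_fst].
pose sw : {mfun (BV * BV)%type >-> (BV * BV)%type} := mfun_Sub (mem_set msw).
exists (distribution pi sw).
  split=> B mB.
  - rewrite -h2//; congr (pi _); apply/seteqP; split=> [[x y] []|[x y] []]//=.
  - rewrite -h1//; congr (pi _); apply/seteqP; split=> [[x y] []|[x y] []]//=.
have cost_ge0 (z : BV * BV) : (0 <= ((Defs.edist z.1 z.2 : R) ^+ 2)%:E)%E.
  by rewrite lee_fin sqr_ge0.
rewrite (@ge0_integral_distribution _ _ _ _ _ pi sw _ measurable_sqr_edist cost_ge0).
apply: eq_integral => -[x y] _ /=; congr ((_ ^+ 2)%:E).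
rewrite /Defs.edist /enorm -opprB dotvNl; congr Num.sqrt.
by rewrite /dotv -sumrN; apply: eq_bigr => i _; rewrite !mxE mulrN opprK.
Qed.

End Wasserstein.

(** * Equilibria *)

Section Fibers.
Context {R : realType} {d : nat} {T : R}.
Local Notation V := 'rV[R]_d.

(** Over almost every x, both disintegrations charge the unique element of M x
    only. *)
Lemma fibers_in_unique (m0 : P2 R d) (M : V -> set (@Gamma R d T))
    (eta1 eta2 : probability (@Gamma R d T) R) :
  (forall x, exists gamma, M x `<=` [set gamma]) ->
  fibers_in m0 M eta1 -> fibers_in m0 M eta2 ->
  forall A : set (@Gamma R d T), measurable A -> eta1 A = eta2 A.
Proof.
move=> M1 [k1 [[e1 _] s1]] [k2 [[e2 _] s2]] A mA; rewrite e1// e2//.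
apply: ae_eq_integral => //.
- exact: measurable_kernel.
- exact: measurable_kernel.
- apply: filterS2 s1 s2 => x s1 s2 _; have [gamma Mg] := M1 x.
  rewrite (@spt_sub1_dirac _ _ _ (k1 x) gamma)//; last 2 first.
    exact: prob_kernel.
    exact: subset_trans s1 Mg.
  rewrite (@spt_sub1_dirac _ _ _ (k2 x) gamma)//.
    exact: prob_kernel.
  exact: subset_trans s2 Mg.
Qed.

Lemma eq_minimizers (l l' : R -> V -> V -> R) (gT gT' : V -> R) :
  (forall s x v, 0 <= s <= T -> l s x v = l' s x v) -> gT =1 gT' ->
  forall x, @minimizers R d T l gT x = minimizers l' gT' x.
Proof.
move=> ll gg x.
have costE (gamma : curve d T) : cost l gT gamma = cost l' gT' gamma.
  rewrite /cost gg; congr (- _ + _)%E; apply: eq_integral => s.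
  by rewrite inE /= in_itv/= => sT; rewrite ll.
by rewrite /minimizers; apply/seteqP; split=> gamma [g0 gmin]; split=> // gamma' /gmin;
  rewrite !costE.
Qed.

Lemma flow_of_P2_eq (eta : probability (@Gamma R d T) R) (m m' : R -> P2 R d) :
  flow_of eta m -> flow_of eta m' -> forall t, 0 <= t <= T -> P2_eq (m t) (m' t).
Proof. by move=> fm fm' t tT B mB; rewrite -fm// -fm'. Qed.

Lemma AC_flow (eta : probability (@Gamma R d T) R) (m : R -> P2 R d) :
  has_AC_flow eta -> flow_of eta m -> AC_P2 T m.
Proof.
move=> [m' fm' [f fi fm'_ac]] fm; exists f => // s t s0 st tT.
have E := flow_of_P2_eq fm fm'.
rewrite (W2_P2_eq (E s _) (E t _)) ?s0 ?tT ?(le_trans st tT) ?(le_trans s0 st)//.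
exact: fm'_ac.
Qed.

Lemma AC_P2_modulus (m : R -> P2 R d) (e : R) : AC_P2 T m -> 0 < e ->
  exists2 delta : R, 0 < delta & forall s t, 0 <= s <= T -> 0 <= t <= T ->
    `|s - t| < delta -> W2 (m s) (m t) < e.
Proof.
move=> mac e0; have [delta delta0 mod] := abs_continuous_modulus mac e0.
exists delta => //.
move=> s t /andP[s0 sT] /andP[t0 tT] st_d.
have [st|ts] := leP s t.
  by apply: mod => //; rewrite (le_lt_trans _ st_d)// distrC ler_norm.
by rewrite W2_sym; apply: mod => //; rewrite ?(ltW ts)// (le_lt_trans _ st_d)// ler_norm.
Qed.

Lemma lagrangian_along_flow_continuous (L : R -> V -> V -> P2 R d -> R) (m : R -> P2 R d) :
  @jointly_continuous R d R^o T L -> AC_P2 T m ->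
  {within [set z : R * V * V | 0 <= z.1.1 <= T],
    continuous (fun z : R * V * V => L z.1.1 z.1.2 z.2 (m z.1.1))}.
Proof.
move=> cL mac; apply/subspace_continuousP => -[[s x] v] /= sT.
apply/cvgrPdist_lt => e e0.
have [delta delta0 close] := cL s x v (m s) sT e e0.
have [eta eta0 mclose] := AC_P2_modulus mac delta0.
pose r := Num.min (Num.min delta eta) (delta / d.+1%:R).
have r0 : 0 < r by rewrite !lt_min delta0 eta0 divr_gt0.
have edist_lt (y y' : V) : `|y - y'| < delta / d.+1%:R -> Defs.edist y' y < delta.
  move=> yy'; rewrite (le_lt_trans (enorm_le_norm _))// mulrC -ltr_pdivlMr//.
  by rewrite distrC.
rewrite /within /=; apply/nbhs_ballP; exists r => //= -[[s' x'] v'] [[/= bs bx] bv] s'T.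
rewrite distrC.
rewrite mx_norm_ball /ball_ /= in bx; rewrite mx_norm_ball /ball_ /= in bv.
have {}bs : `|s - s'| < r by exact: bs.
have rd : r <= delta / d.+1%:R by rewrite /r ge_min lexx orbT.
have rdelta : r <= delta by rewrite /r !ge_min lexx.
have reta : r <= eta by rewrite /r !ge_min lexx orbT.
apply: close => //.
- by rewrite distrC (lt_le_trans bs).
- by apply: edist_lt; rewrite (lt_le_trans bx).
- by apply: edist_lt; rewrite (lt_le_trans bv).
- by apply: mclose => //; rewrite distrC (lt_le_trans bs).
Qed.

End Fibers.

Theorem proposition3p2
  (R : realType) (d : nat) (T : R) (hT : 0 < T)
  (X : completeNormedModType R) (ip : {dot X for idfun})
  (hip : forall x : X, ip x x = `|x| ^+ 2)
  (G : 'rV[R]_d -> P2 R d -> R) (g : 'rV[R]_d -> X -> R)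
  (hG : C1_data T (fun _ x _ mu => G x mu)) :
  (forall (L : R -> 'rV[R]_d -> 'rV[R]_d -> P2 R d -> R)
     (l : R -> R -> 'rV[R]_d -> 'rV[R]_d -> X -> R)
     (Sigma : R -> (R -> P2 R d) -> (R -> X)),
     C1_data T L ->
     (forall T', 0 < T' -> is_curve_map T' (Sigma T')) ->
     (forall m, AC_P2 T m -> forall x, G x (m T) = g x (Sigma T m T)) ->
     (forall m, AC_P2 T m -> forall s x v, 0 <= s <= T ->
        L s x v (m s) = l T s x v (Sigma T m s)) ->
     strict_Sigma_condition ip l g Sigma ->
     (forall sigma, range_Sigma T (Sigma T) sigma ->
        HJ_hypothesis T (fun t x v => l T t x v (sigma t))
                        (fun x => g x (sigma T))) ->
     forall (m0 : P2 R d) (eta1 eta2 : probability (@Gamma R d T) R),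
       has_AC_flow eta1 -> nash_equilibrium L G m0 eta1 ->
       has_AC_flow eta2 -> nash_equilibrium L G m0 eta2 ->
       forall A : set (@Gamma R d T), measurable A -> eta1 A = eta2 A)
  /\
  (forall (L : 'rV[R]_d -> 'rV[R]_d -> R) (SigmaT : P2 R d -> X),
     C1_data T (fun _ x v _ => L x v) ->
     (forall mu nu, P2_eq mu nu -> SigmaT mu = SigmaT nu) ->
     (forall x mu, G x mu = g x (SigmaT mu)) ->
     strict_sigma_condition ip L g SigmaT ->
     (forall sigma, range SigmaT sigma ->
        HJ_hypothesis T (fun _ x v => L x v) (fun x => g x sigma)) ->
     forall (m0 : P2 R d) (eta1 eta2 : probability (@Gamma R d T) R),
       nash_equilibrium (fun _ x v _ => L x v) G m0 eta1 ->
       nash_equilibrium (fun _ x v _ => L x v) G m0 eta2 ->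
       forall A : set (@Gamma R d T), measurable A -> eta1 A = eta2 A).
Proof.
split=> [L l Sigma cL _ GE LE mono HJ m0 eta1 eta2 ac1 [i1 [m1 f1 fib1]] ac2
         [i2 [m2 f2 fib2]]|L SigmaT cL _ GE mono HJ m0 eta1 eta2
         [i1 [m1 f1 fib1]] [i2 [m2 f2 fib2]]].
- have mac1 := AC_flow ac1 f1; have mac2 := AC_flow ac2 f2.
  have minE m : AC_P2 T m -> forall x,
      @minimizers R d T (fun s x v => L s x v (m s)) (fun x => G x (m T)) x =
      minimizers (fun s x v => l T s x v (Sigma T m s)) (fun x => g x (Sigma T m T)) x.
    by move=> mac; apply: eq_minimizers => [s x v sT|x]; [exact: LE|exact: GE].
  rewrite (funext (minE m1 mac1)) in fib1; rewrite (funext (minE m2 mac2)) in fib2.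
  have r1 : range_Sigma T (Sigma T) (Sigma T m1) by exists m1.
  have r2 : range_Sigma T (Sigma T) (Sigma T m2) by exists m2.
  have E1 : E_Sigma T (l T) g (Sigma T) m0 (Sigma T m1) (Sigma T m1).
    by exists eta1, m1; split.
  have E2 : E_Sigma T (l T) g (Sigma T) m0 (Sigma T m2) (Sigma T m2).
    by exists eta2, m2; split.
  (* An equilibrium gives a fixed point sigma of the best response, to which the
     strict condition is applied with tau = sigma. *)
  have sigmaE : eq_on_time T (Sigma T m1) (Sigma T m2).
    apply: contrapT => ne; have [_ /(_ ne)] := mono m0 T hT _ _ _ _ r1 r2 E1 E2.
    by rewrite ltxx.
  have minE12 : forall x,
      @minimizers R d T (fun s x v => l T s x v (Sigma T m2 s)) (fun x => g x (Sigma T m2 T)) x =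
      minimizers (fun s x v => l T s x v (Sigma T m1 s)) (fun x => g x (Sigma T m1 T)) x.
    by apply: eq_minimizers => [s x v sT|x]; rewrite sigmaE// lexx ltW.
  rewrite (funext minE12) in fib2.
  apply: (fibers_in_unique _ fib1 fib2); apply: unique_minimizer (HJ _ r1) => //.
  have [cLj _ _ _] := cL.
  apply: subspace_eq_continuous (lagrangian_along_flow_continuous cLj mac1).
  by move=> z; rewrite inE /= => zT; exact: LE.
- have minE m : forall x,
      @minimizers R d T (fun s x v => L x v) (fun x => G x (m T)) x =
      minimizers (fun s x v => L x v) (fun x => g x (SigmaT (m T))) x.
    by apply: eq_minimizers => // x; exact: GE.
  have TT : 0 <= T <= T by rewrite lexx ltW.
  rewrite (funext (minE m1)) in fib1; rewrite (funext (minE m2)) in fib2.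
  have r1 : range SigmaT (SigmaT (m1 T)) by exists (m1 T).
  have r2 : range SigmaT (SigmaT (m2 T)) by exists (m2 T).
  have E1 : E_terminal T L g SigmaT m0 (SigmaT (m1 T)) (SigmaT (m1 T)).
    by exists eta1, (m1 T); split => //; exact: f1.
  have E2 : E_terminal T L g SigmaT m0 (SigmaT (m2 T)) (SigmaT (m2 T)).
    by exists eta2, (m2 T); split => //; exact: f2.
  have sigmaE : SigmaT (m1 T) = SigmaT (m2 T).
    apply: contrapT => ne; have [_ /(_ ne)] := mono m0 T hT _ _ _ _ r1 r2 E1 E2.
    by rewrite hip ltxx.
  rewrite -sigmaE in fib2.
  apply: (fibers_in_unique _ fib1 fib2); apply: unique_minimizer (HJ _ r1) => //.
  (* L depends on (x, v) alone, and is differentiable in it. *)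
  have [_ dL _ _] := cL.
  have cont (z : 'rV[R]_d * 'rV[R]_d) : {for z, continuous (fun z => L z.1 z.2)}.
    by apply: differentiable_continuous; apply: (dL 0 m0 _ z); rewrite lexx ltW.
  apply: continuous_subspaceT => -[[s x] v].
  apply: (@continuous_comp _ _ _ (fun z : R * 'rV[R]_d * 'rV[R]_d => (z.1.2, z.2))
    (fun z => L z.1 z.2)); last exact: cont.
  apply: (@cvg_nbhs_pair _ (nbhs (s, x, v)) _ _ (fun z : R * 'rV[R]_d * 'rV[R]_d => z.1.2) snd x v).
    apply: (@cvg_comp _ _ _ fst snd _ (nbhs (s, x))); first exact: cvg_fst.
    exact: cvg_snd.
  exact: cvg_snd.
Qed.
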